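(* Let $p>0$ and let either $(s,\beta)\in(0,+\infty)\times(-1,+\infty)$ or $(s,\beta)\in(0,1]\times\{-1\}$. Let $\omega\in RV(s)$, and let $\mu\in\mathcal R(x_0,\beta)$ with associated function $\nu\in RV(\beta)$. Let $h_n$ be the smallest solution to $$\omega(h)=\frac{\sigma}{\sqrt{2n\int_0^h\nu(t)\,dt}},$$ let $\alpha_n=O(n^{\gamma})$ for some $\gamma>0$, and let $\Sigma=\Sigma_{h_n,\alpha_n}(x_0,\omega)$. Then $$\mathcal R_n(\Sigma,\mu)\asymp\sigma^{2s/(1+2s+\beta)}\,n^{-s/(1+2s+\beta)}\,\ell_{\omega,\nu}(n^{-1})\qquad\text{as }n\to+\infty,$$ where $\ell_{\omega,\nu}$ is slowly varying and $\asymp$ stands for equality in order, up to constants depending on $s,\beta$ and $p$ but not on $\sigma$. Moreover, the minimax rate is equal to $\omega(h_n)$.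
   Context: Model: one observes $n$ i.i.d. pairs $(X_i,Y_i)\in\mathbb R\times\mathbb R$ with $Y_i=f(X_i)+\xi_i$, where $f$ is the unknown regression function, the $\xi_i$ are centered Gaussian with variance $\sigma^2$, independent of $X_1,\dots,X_n$, and the $X_i$ have density $\mu$. The function $f$ is to be estimated at a fixed point $x_0$. $\mathbb P^n_{f,\mu}$ is the joint law of $(X_i,Y_i)_{i\le n}$ and $\mathbb E^n_{f,\mu}$ its expectation. Minimax risk: $\mathcal R_n(\Sigma,\mu)=\bigl(\inf_{T_n}\sup_{f\in\Sigma}\mathbb E^n_{f,\mu}\{|T_n(x_0)-f(x_0)|^p\}\bigr)^{1/p}$, the infimum being over all estimators $T_n$ based on the observations. Saying that the minimax rate is $\omega(h_n)$ means that $\mathcal R_n(\Sigma,\mu)$ is of order $\omega(h_n)$ in the sense of $\asymp$. Regular variation: with $\mathbb R^+$ the positive half-line, a continuous function $g:\mathbb R^+\to\mathbb R^+$ is in $RV(b)$, $b\in\mathbb R$, if $\lim_{h\to0^+}g(yh)/g(h)=y^{b}$ for all $y>0$. Functions in $RV(0)$ are called slowly varying. Design class: $\mathcal R(x_0,\beta)$ is the set of densities $\mu$ such that, for a fixed neighbourhood $W$ of $x_0$ and some $\nu\in RV(\beta)$, $\mu(x)=\nu(|x-x_0|)$ for all $x\in W$. Function class: for $\delta>0$ and $\omega\in RV(s)$ with $s>0$, let $k$ be the largest integer (strictly) smaller than $s$ and $\mathcal P_k$ the set of real polynomials of degree $k$ (at most). $\mathcal F_\delta(x_0,\omega)$ is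 the class of functions $f:[0,1]\to\mathbb R$ such that $\inf_{P\in\mathcal P_k}\sup_{|x-x_0|\le h}|f(x)-P(x-x_0)|\le\omega(h)$ for all $h\le\delta$. For $\alpha>0$, $\mathcal U(\alpha)=\{f:[0,1]\to\mathbb R:\ \|f\|_\infty\le\alpha\}$, and $\Sigma_{\delta,\alpha}(x_0,\omega)=\mathcal F_\delta(x_0,\omega)\cap\mathcal U(\alpha)$.
   Formalization: The formal theorem also assumes ω(h_n) ≤ α_n for all large n: α_n = O(n^γ) alone allows α_n to tend to 0 faster than the rate (e.g. α_n = 1/n with s=1, β=0), and then the zero estimator has risk at most α_n, so the lower bound fails. *)

(* Defs.v *)
From HB Require Import structures.
From mathcomp Require Export all_boot all_order all_algebra.
From mathcomp Require Export all_classical all_reals all_analysis.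
From mathcomp Require Export measurable_realfun.

Set Implicit Arguments.
Unset Strict Implicit.
Unset Printing Implicit Defensive.

Import Order.TTheory GRing.Theory Num.Theory.
Export numFieldNormedType.Exports.

Local Open Scope classical_set_scope.
Local Open Scope ring_scope.

(* Functions on the open half-line ]0, +oo[ are represented by total functions
   R -> R; their values outside ]0, +oo[ are never used. *)
Definition RV (R : realType) (b : R) (g : R -> R) : Prop :=
  [/\ {in `]0, +oo[, continuous g},
      forall h, 0 < h -> 0 < g h &
      forall y, 0 < y -> g (y * h) / g h @[h --> 0^'+] --> y `^ b].

(* The regression functions live on [0, 1], so the design points must too. *)
Record design_density (R : realType) := DesignDensity {
  design_fun :> R -> R;
  design_measurable : measurable_fun [set: R] design_fun;
  design_ge0 : forall x, 0 <= design_fun x;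
  design_support : forall x, x \notin `[0, 1] -> design_fun x = 0;
  design_integral : (\int[lebesgue_measure]_x (design_fun x)%:E = 1)%E }.

Section design_law.
Context (R : realType) (mu : design_density R).
Local Open Scope ereal_scope.

Definition design_law : set (measurableTypeR R) -> \bar R :=
  fun A => \int[lebesgue_measure]_(x in A) (mu x)%:E.

Let design0 : design_law set0 = 0.
Proof. by rewrite /design_law integral_set0. Qed.

Let design_law_ge0 A : 0 <= design_law A.
Proof. by apply: integral_ge0 => x _; rewrite lee_fin design_ge0. Qed.

Let design_sigma_additive : semi_sigma_additive design_law.
Proof.
move=> /= F mF tF mUF; rewrite /design_law; apply: cvg_toP.
  apply: ereal_nondecreasing_is_cvgn => m n mn.
  apply: lee_sum_nneg_natr => // k _ _.
  by apply: integral_ge0 => /= x Fkx; rewrite lee_fin design_ge0.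
have mE : measurable_fun [set: measurableTypeR R] (EFin \o mu).
  by apply/measurable_EFinP; exact: design_measurable.
rewrite ge0_integral_bigcup//=; first exact: (measurable_funS measurableT _ mE).
by move=> x _; rewrite lee_fin design_ge0.
Qed.

HB.instance Definition _ := isMeasure.Build _ _ _ design_law
  design0 design_law_ge0 design_sigma_additive.

Let design_setT : design_law [set: measurableTypeR R] = 1%:E.
Proof. exact: design_integral. Qed.

HB.instance Definition _ := @Measure_isProbability.Build _ _ R
  design_law design_setT.

End design_law.

Section cons_mfun.
Context d (T : measurableType d) (n : nat).

Definition tcons (x : T * n.-tuple T) : n.+1.-tuple T := [tuple of x.1 :: x.2].

Let measurable_tcons : measurable_fun setT tcons.
Proof. exact: measurable_cons. Qed.

HB.instance Definition _ := isMeasurableFun.Build _ _ _ _ tcons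
  measurable_tcons.

End cons_mfun.

(* The n-fold product of P. *)
Fixpoint iid_law d (T : measurableType d) (R : realType) (P : probability T R)
    (n : nat) : probability (n.-tuple T) R :=
  match n with
  | 0%N => dirac [tuple]
  | m.+1 => distribution (P \x iid_law P m)%E (@tcons d T m)
  end.

Section regression_model.
Context (R : realType).

Section observe.
Variable f : {mfun R >-> R}.

Definition observe (u : measurableTypeR R * measurableTypeR R) : R * R :=
  (u.1, f u.1 + u.2).

Let measurable_observe : measurable_fun setT observe.
Proof.
apply: measurable_fun_pair => /=; first exact: measurable_fst.
apply: measurable_funD; last exact: measurable_snd.
apply: (@measurableT_comp _ _ _ _ _ _ f); last exact: measurable_fst.
exact: measurable_funPT.
Qed.

HB.instance Definition _ := isMeasurableFun.Build _ _ _ _ observe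
  measurable_observe.

End observe.

(* The law of (X, f X + xi), where X has density mu and xi is an independent
   centered Gaussian variable with standard deviation sigma. *)
Definition observation_law (f : {mfun R >-> R}) (mu : design_density R)
    (sigma : R) : probability (R * R)%type R :=
  distribution (design_law mu \x normal_prob 0 sigma)%E (observe f).

Definition sample_law (f : {mfun R >-> R}) (mu : design_density R)
    (sigma : R) (n : nat) : probability (n.-tuple (R * R)) R :=
  iid_law (observation_law f mu sigma) n.

(* A regression function [0, 1] -> R is represented by any of its Borel
   extensions to R: neither the class Sigma considered below nor the risk
   depends on the extension. An estimator of f x0 is any Borel function of the
   observations; it may depend on everything but f. *)
Definition minimax_risk (p sigma x0 : R) (Sigma : set (R -> R))
    (mu : design_density R) (n : nat) : \bar R :=
  (ereal_inf [set
     ereal_sup [set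
       \int[sample_law f mu sigma n]_z ((`|T z - f x0| `^ p)%R)%:E
     | f in [set f : {mfun R >-> R} | Sigma f]]
   | T in [set: {mfun (n.-tuple (R * R)) >-> R}]] `^ p^-1)%E.

Definition design_class (x0 beta : R) (nu : R -> R) : set (design_density R) :=
  [set mu | RV beta nu /\ \forall x \near x0^', mu x = nu `|x - x0|].

(* The largest integer strictly smaller than s, for s > 0. *)
Definition degree_of (s : R) : nat := `|Num.ceil s|%N.-1.

Lemma degree_ofP (s : R) : 0 < s ->
  (degree_of s)%:R < s /\ forall m : int, m%:~R < s -> m <= (degree_of s)%:Z.
Proof.
move=> s0; have c0 : 0 < Num.ceil s by rewrite ceil_gt0.
have eqk : (degree_of s)%:Z = Num.ceil s - 1.
  by rewrite /degree_of; case: (Num.ceil s) c0 => -[|k] // _; rewrite /= -addn1 PoszD addrK.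
split=> [|m]; last by rewrite -ceil_gt_int eqk lerBrDr lezD1.
by rewrite -[_%:R]/((degree_of s)%:Z%:~R) eqk; case/andP: (ceil_itv s).
Qed.

Definition local_class (delta x0 s : R) (omega : R -> R) : set (R -> R) :=
  [set f | forall h, 0 < h <= delta ->
    (ereal_inf [set
       ereal_sup [set (`|f x - P.[x - x0]|%R)%:E
       | x in [set x | x \in `[0%R, 1%R] /\ (`|x - x0| <= h)%R]]
     | P in [set P : {poly R} | (size P <= (degree_of s).+1)%N]]
     <= (omega h)%:E)%E].

Definition bounded_class (alpha : R) : set (R -> R) :=
  [set f | forall x, x \in `[0, 1] -> `|f x| <= alpha].

Definition Sigma_class (delta alpha x0 s : R) (omega : R -> R) :
    set (R -> R) :=
  local_class delta x0 s omega `&` bounded_class alpha.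

Definition bandwidth_equation (sigma : R) (omega nu : R -> R) (n : nat)
    (h : R) : Prop :=
  omega h = sigma /
    Num.sqrt (2 * n%:R * \int[lebesgue_measure]_(t in `]0, h]) nu t).

Definition smallest_bandwidth (sigma : R) (omega nu : R -> R) (n : nat)
    (h : R) : Prop :=
  [/\ 0 < h, bandwidth_equation sigma omega nu n h &
      forall h', 0 < h' -> bandwidth_equation sigma omega nu n h' -> h <= h'].

(* Equality in order at infinity, with explicit constants c and C. *)
Definition same_order (c C : R) (u : nat -> \bar R) (v : nat -> R) : Prop :=
  \forall n \near \oo, ((c * v n)%:E <= u n <= (C * v n)%:E)%E.

End regression_model.

(* Main.v *)
From HB Require Import structures.
Require Import Defs.
From mathcomp Require Import all_boot all_order all_algebra.
From mathcomp Require Import all_classical all_reals all_analysis.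
From mathcomp Require Import measurable_realfun.
From mathcomp Require Import ring lra.
Import Order.TTheory GRing.Theory Num.Theory.
Set Implicit Arguments.
Unset Strict Implicit.
Unset Printing Implicit Defensive.
Local Open Scope classical_set_scope.
Local Open Scope ring_scope.

(** Write V(h) for the integral of nu over ]0, h], k for the degree attached to
s and rho = 1 + 2s + beta. The bandwidth equation reads
sigma^2 = 2 n V(h_n) omega(h_n)^2: a window of half-width h_n around x0 holds
about 2 n V(h_n) design points, so the standard deviation of an average over it
is omega(h_n), which is also the approximation error that the class allows at
that scale. Hence omega(h_n) is the minimax rate, and it remains to compute it.

Lower bound ([minimax_two_point]). The class constrains f only at scales
h <= h_n. The function equal to omega(h_n) / 2 on the window and to 0 outside is
constant at all these scales, so it belongs to the class, as does 0. By the
bandwidth equation the likelihood ratio of these two hypotheses has a second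
moment at most 2 ([chi2_bump]), so no estimator tells them apart.

Upper bound ([minimax_upper]). Cut the right half of the window into k + 1
blocks separated by gaps. Choose one observation in each block, interpolate them
by a polynomial of degree k, take its value at x0, and average over all choices.
The resulting linear estimator is exact on polynomials of degree k whatever the
design is, and its weights are bounded by a constant over the number m of points
in the emptiest block. Given the design, its error is a bias of order omega(h_n)
plus a Gaussian variable whose exponential moments are explicit. Every block
carries a fixed share of V(h_n) ([block_mass]), so that m may be taken of order
sigma^2 / omega(h_n)^2. A block holds fewer than m points with probability at
most exp(-m), and then the error is at most alpha_n; this is negligible because
alpha_n is at most a power of n, hence of 1 / omega(h_n) ([tail_negligible]).

Form of the rate ([rate_function]). The function omega^2 V is regularly varying
with index rho, and h_n is the first point where it reaches sigma^2 / (2n), so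
its running maximum equals sigma^2 / (2n) at h_n. Integrals and running maxima
inherit regular variation from ratio bounds that hold for all small arguments,
and being monotone they can be inverted and composed; this takes the place of
the uniform convergence theorem. If K is the inverse of the running maximum
(made strictly increasing), then h_n is about K(sigma^2 / (2n)), and
omega(h_n) = sigma / sqrt(2 n V(h_n)) is governed by V o K, which is monotone
and regularly varying. Comparing V o K at sigma^2 / (2n) and at 1 / n gives the
power of sigma, and l does not depend on sigma.

If nu is not integrable near 0, no design density is associated with it. *)

(** * Regular variation *)

Section regular_variation.
Context (R : realType).
Implicit Types (g F K V : R -> R) (a b c y h d rho : R).

Lemma near0rP (P : R -> Prop) :
  (\forall h \near 0^'+, P h) <->
  exists2 d, 0 < d & forall h, 0 < h < d -> P h.
Proof.
split.
  rewrite /at_right near_withinE => -[d /= d0 dP]; exists d => // h /andP[h0 hd].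
  by apply: dP => //=; rewrite sub0r normrN gtr0_norm.
move=> [d d0 dP]; near=> h; apply: dP; apply/andP; split; near: h.
  exact: nbhs_right_gt.
exact: nbhs_right_lt.
Unshelve. all: by end_near. Qed.

Lemma RV_gt0 b g h : RV b g -> 0 < h -> 0 < g h.
Proof. by move=> [_ + _]; apply. Qed.

Lemma RV_continuous b g h : RV b g -> 0 < h -> {for h, continuous g}.
Proof. by move=> [+ _ _] h0; apply; rewrite in_itv/= h0. Qed.

Lemma RV_within b g (a c : R) : RV b g -> 0 < a -> {within `[a, c], continuous g}.
Proof.
move=> gb a0; apply: continuous_in_subspaceT => x.
rewrite inE/= in_itv/= => /andP[ax _]; apply: (RV_continuous gb).
exact: lt_le_trans ax.
Qed.

(** The limit in the definition as a two-sided bound, valid for all small h at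
once: in this form it can be integrated and passed to suprema. *)
Lemma RV_ratio b g y lo hi : RV b g -> 0 < y -> lo < y `^ b -> y `^ b < hi ->
  exists2 d, 0 < d & forall h, 0 < h < d -> lo * g h < g (y * h) < hi * g h.
Proof.
move=> [_ gp gb] y0 loy yhi; apply/near0rP; near=> h.
have h0 : 0 < h by near: h; exact: nbhs_right_gt.
rewrite -(ltr_pdivlMr _ _ (gp _ h0)) -(ltr_pdivrMr _ _ (gp _ h0)); apply/andP; split; near: h.
  exact: (cvgr_gt _ (gb y y0)).
exact: (cvgr_lt _ (gb y y0)).
Unshelve. all: by end_near. Qed.

Lemma RV_intro b g : {in `]0, +oo[, continuous g} ->
  (forall h, 0 < h -> 0 < g h) ->
  (forall y lo hi, 0 < y -> 0 < lo -> lo < y `^ b -> y `^ b < hi ->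
    exists2 d, 0 < d &
      forall h, 0 < h < d -> lo * g h <= g (y * h) <= hi * g h) ->
  RV b g.
Proof.
move=> gc gp gb; split => // y y0; apply/cvgrPdist_le => /= e e0.
have yb : 0 < y `^ b by rewrite powR_gt0.
pose lo := Num.max (y `^ b / 2) (y `^ b - e).
have lo0 : 0 < lo by rewrite lt_max divr_gt0.
have loy : lo < y `^ b by rewrite gt_max ltrBlDr ltrDl e0 andbT ltr_pdivrMr// ltr_pMr// ltr1n.
have [d d0 dP] := gb y lo (y `^ b + e) y0 lo0 loy (ltr_pwDr e0 (lexx _)).
apply/near0rP; exists d => // h hd; have /andP[h0 _] := hd.
have /andP[l u] := dP _ hd.
have gh := gp _ h0.
rewrite ler_distlC ler_pdivlMr// ler_pdivrMr// u andbT.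
by apply: le_trans l; rewrite ler_pM2r// le_max lexx orbT.
Qed.

Lemma RV_id : RV 1 (@id R).
Proof.
split => [x _|//|y y0]; first exact: cvg_id.
rewrite powRr1 ?ltW//; apply: cvg_near_cst.
apply/near0rP; exists 1 => // h /andP[h0 _].
by rewrite mulfK// gt_eqF.
Qed.

Lemma RV_mul b c g f : RV b g -> RV c f -> RV (b + c) (fun h => g h * f h).
Proof.
move=> [gc gp gb] [fc fp fb]; split => [x x0|h h0|y y0].
- by apply: cvgM; [exact: gc|exact: fc].
- by rewrite mulr_gt0// ?gp ?fp.
- rewrite powRD; last by rewrite (gt_eqF y0) implybT.
  under eq_fun do rewrite invfM mulrACA.
  by apply: cvgM; [exact: gb|exact: fb].
Qed.

Lemma continuous_powRl (a x : R) : 0 < x -> {for x, continuous (@powR R ^~ a)}.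
Proof.
move=> x0; apply/differentiable_continuous/derivable1_diffP.
by apply: derivable_powR; rewrite in_itv/= x0.
Qed.

Lemma RV_pow a b g : RV b g -> RV (b * a) (fun h => g h `^ a).
Proof.
move=> [gc gp gb]; split => [x x0|h h0|y y0].
- apply: (@continuous_comp _ _ _ g (@powR R ^~ a)); first exact: gc.
  by apply: continuous_powRl; apply: gp; move: x0; rewrite in_itv/= andbT.
- by rewrite powR_gt0// gp.
- have yb : 0 < y `^ b by rewrite powR_gt0.
  rewrite powRrM; apply: (@cvg_trans _ ((g (y * h) / g h) `^ a @[h --> 0^'+])).
    apply: near_eq_cvg; apply/near0rP; exists 1 => // h /andP[h0 _].
    have gh := gp h h0; have gyh := gp _ (mulr_gt0 y0 h0).
    rewrite powRM ?invr_ge0 ?ltW// -(powR_inv1 (ltW gh)).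
    by rewrite -powRrM mulN1r powRN.
  exact: (cvg_comp _ _ (gb y y0) (@continuous_powRl a _ yb)).
Qed.

(** Halving a small argument multiplies g by a factor below some q < 1, so g
decays geometrically from its maximum over one dyadic interval. *)
Lemma RV_cvg0 b g : RV b g -> 0 < b -> forall e, 0 < e ->
  exists2 d, 0 < d & forall h, 0 < h < d -> g h < e.
Proof.
move=> gb b0 e e0.
have q1 : (2^-1 : R) `^ b < 1.
  have o : (1 : R) `^ b = 1 by rewrite powR1.
  rewrite -[ltRHS]o.
  apply: gt0_ltr_powR => //.
  - by rewrite nnegrE invr_ge0.
  - by rewrite nnegrE.
  - by lra.
(* any q strictly between the limit ratio and 1 *)
pose q : R := ((2^-1 : R) `^ b + 1) / 2.
have q0 : 0 < q by rewrite divr_gt0// ltr_pwDr// powR_ge0.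
have qq : (2^-1 : R) `^ b < q by rewrite /q; lra.
have ql1 : q < 1 by rewrite /q; lra.
have [d d0 dP] := @RV_ratio _ _ 2^-1 (-1) q gb (ltac:(by rewrite invr_gt0))
  (lt_le_trans (ltrN10 _) (powR_ge0 _ _)) qq.
have half h : 0 < h < d -> g (h / 2) <= q * g h.
  by move=> /dP/andP[_ /ltW]; rewrite mulrC.
pose h0 := d / 2.
have h00 : 0 < h0 by rewrite divr_gt0.
have h0d : h0 < d by rewrite /h0; lra.
have [c cP gc] := @EVT_max R g (h0 / 2) h0 (ltac:(rewrite /h0; lra))
  (RV_within gb (divr_gt0 h00 (ltr0Sn _ 1))).
pose M := g c.
have M0 : 0 < M.
  apply: (RV_gt0 gb); move: cP; rewrite in_itv/= => /andP[+ _].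
  by apply: lt_le_trans; rewrite divr_gt0.
(* climb by doublings into the dyadic interval where M is the maximum *)
have gM : forall m h, h0 / 2 ^+ m < h -> h <= h0 -> g h <= M.
  elim=> [|m IH] h; first by rewrite expr0 divr1 => /lt_geF ->.
  move=> mh hh0; have [hs|hs] := ltP h (h0 / 2); last first.
    by apply: gc; rewrite in_itv/= hs.
  have hp : 0 < h by apply: le_lt_trans mh; rewrite divr_ge0// ?ltW// exprn_gt0.
  rewrite -[h](mulfK (x := 2))// (le_trans (half _ _))//.
    by apply/andP; split; lra.
  rewrite (le_trans _ (IH (h * 2) _ _))//.
  - by rewrite ler_piMl ?ltW// (RV_gt0 gb)// mulr_gt0.
  - by move: mh; rewrite exprS invfM mulrCA mulrC ltr_pdivrMr.
  - by lra.
have gM0 h : 0 < h -> h <= h0 -> g h <= M.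
  move=> hp hh0; have [m mP] : exists m, h0 / h < 2 ^+ m :> R.
    by exists (Num.bound (h0 / h)); exact: upper_nthrootP.
  by apply: (gM m) => //; rewrite ltr_pdivrMr ?exprn_gt0// mulrC -ltr_pdivrMr.
have gq : forall n h, 0 < h -> h <= h0 / 2 ^+ n -> g h <= q ^+ n * M.
  elim=> [|n IH] h hp; first by rewrite expr0 divr1 mul1r; exact: gM0.
  move=> hn; rewrite -[h](mulfK (x := 2))//.
  have hn2 : h * 2 <= h0 / 2 ^+ n.
    by move: hn; rewrite exprS invfM mulrCA mulrC ler_pdivlMr.
  have h2h0 : h * 2 <= h0.
    by apply: le_trans hn2 _; rewrite ler_pdivrMr ?exprn_gt0// ler_peMr ?exprn_ege1 ?ler1n ?ltW.
  rewrite (le_trans (half _ _))//; first by apply/andP; split; lra.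
  by rewrite exprS -mulrA ler_pM2l// IH// mulr_gt0.
have [n _ nP] : \forall n \near \oo, q ^+ n < e / M.
  by apply: cvgr_lt (divr_gt0 e0 M0); apply: cvg_expr; rewrite gtr0_norm.
exists (h0 / 2 ^+ n) => [|h /andP[hp hn]]; first by rewrite divr_gt0// exprn_gt0.
apply: le_lt_trans (gq n h hp (ltW hn)) _.
by rewrite -ltr_pdivlMr//; apply: nP => /=.
Qed.

Definition running_sup g h : R := sup (g @` `]0, h]).

Section running_sup.
Variables (g : R -> R) (rho : R).
Hypotheses (grho : RV rho g) (rho0 : 0 < rho).
Local Notation gs := (running_sup g).

Lemma has_ubound_itv h : has_ubound (g @` `]0, h]).
Proof.
have [d d0 dP] := RV_cvg0 grho rho0 (@ltr01 R).
have d20 : 0 < d / 2 by rewrite divr_gt0.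
have [hd|hd] := leP h (d / 2).
  exists 1 => _ [x /= + <-]; rewrite in_itv/= => /andP[x0 xh].
  by apply/ltW/dP; rewrite x0/=; apply: le_lt_trans xh _; lra.
have [c _ gc] := EVT_max (ltW hd) (RV_within grho d20).
exists (Num.max 1 (g c)) => _ [x /= + <-]; rewrite in_itv/= => /andP[x0 xh].
rewrite le_max; apply/orP; have [xd|xd] := leP x (d / 2).
  by left; apply/ltW/dP; rewrite x0/=; lra.
by right; apply: gc; rewrite in_itv/= xh ltW.
Qed.

Lemma has_sup_itv h : 0 < h -> has_sup (g @` `]0, h]).
Proof.
by move=> h0; split; [exists (g h), h => //=; rewrite in_itv/= h0 lexx|
  exact: has_ubound_itv].
Qed.

Lemma le_running_sup t h : 0 < t <= h -> g t <= gs h.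
Proof.
move=> th; apply: ub_le_sup; first exact: has_ubound_itv.
by exists t => //=; rewrite in_itv.
Qed.

Lemma running_sup_le h M : 0 < h -> (forall t, 0 < t <= h -> g t <= M) ->
  gs h <= M.
Proof.
move=> h0 gM; apply: ge_sup; first by have [] := has_sup_itv h0.
by move=> _ [t /= + <-]; rewrite in_itv/=; exact: gM.
Qed.

Lemma running_sup_gt0 h : 0 < h -> 0 < gs h.
Proof.
move=> h0; apply: (lt_le_trans (RV_gt0 grho h0)).
by apply: le_running_sup; rewrite h0 lexx.
Qed.

Lemma running_sup_nd a c : 0 < a -> a <= c -> gs a <= gs c.
Proof.
move=> a0 ac; apply: running_sup_le => // t /andP[t0 ta].
by apply: le_running_sup; rewrite t0 (le_trans ta ac).
Qed.

(** Between two points close to h, the running maximum grows by at most the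
oscillation of g near h. *)
Lemma running_sup_continuous h : 0 < h -> {for h, continuous gs}.
Proof.
move=> h0; apply/cvgrPdist_le => e e0.
have e2 : 0 < e / 2 by rewrite divr_gt0.
have /cvgrPdist_lt/(_ _ e2)[r /= r0 rP] := RV_continuous grho h0.
have close a c t : 0 < a -> `|h - a| < r -> `|h - c| < r -> a <= t <= c ->
    g t <= gs a + e.
  move=> a0 ha hc tac; have tr : `|h - t| < r.
    move: ha hc tac; rewrite !ltr_norml => /andP[? ?] /andP[? ?] /andP[? ?].
    by apply/andP; split; lra.
  have := rP t tr; have := rP a ha; rewrite /= !ltr_distl.
  have : g a <= gs a by apply: le_running_sup; rewrite a0 lexx.
  by move=> ? /andP[? ?] /andP[? ?]; lra.
have step a c : 0 < a -> a <= c -> `|h - a| < r -> `|h - c| < r ->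
    gs a <= gs c <= gs a + e.
  move=> a0 ac ha hc; rewrite running_sup_nd//=.
  apply: running_sup_le => [|t /andP[t0 tc]]; first exact: lt_le_trans ac.
  have [ta|ta] := leP t a.
    by apply: ler_wpDr; [exact: ltW|apply: le_running_sup; rewrite t0].
  by apply: (close a c) => //; rewrite tc ltW.
exists (Num.min r h) => [|t /=]; first by rewrite /= lt_min r0.
rewrite lt_min => /andP[tr th]; have t0 : 0 < t.
  by move: th; rewrite ltr_norml => /andP[? ?]; lra.
have hh : `|h - h| < r by rewrite subrr normr0.
have [ht|ht] := leP h t.
  have /andP[? ?] := step _ _ h0 ht hh tr.
  by rewrite ler_distl; apply/andP; split; lra.
have /andP[? ?] := step _ _ t0 (ltW ht) tr hh.
by rewrite ler_distl; apply/andP; split; lra.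
Qed.

(** A ratio bound that holds for all t <= h passes to the supremum over t. *)
Lemma running_sup_RV : RV rho gs.
Proof.
apply: RV_intro.
- by move=> x; rewrite in_itv/= andbT; exact: running_sup_continuous.
- exact: running_sup_gt0.
- move=> y lo hi y0 lo0 loy yhi; have [d d0 dP] := RV_ratio grho y0 loy yhi.
  exists d => // h /andP[h0 hd]; apply/andP; split.
  + rewrite mulrC -ler_pdivlMr//; apply: running_sup_le => // t /andP[t0 th].
    rewrite ler_pdivlMr// mulrC.
    have /andP[/ltW + _] := dP t (introT andP (conj t0 (le_lt_trans th hd))).
    move=> /le_trans; apply; apply: le_running_sup.
    by rewrite mulr_gt0//= ler_pM2l.
  + apply: running_sup_le => [|t /andP[t0 th]]; first exact: mulr_gt0.
    have ty0 : 0 < t / y by rewrite divr_gt0.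
    have tyh : t / y <= h by rewrite ler_pdivrMr// mulrC.
    have /andP[_ /ltW] := dP _ (introT andP (conj ty0 (le_lt_trans tyh hd))).
    rewrite mulrCA mulfV ?gt_eqF// mulr1 => /le_trans; apply.
    rewrite ler_pM2l; first by apply: le_running_sup; rewrite ty0.
    by apply: lt_trans yhi; rewrite powR_gt0.
Qed.

End running_sup.

(** Monotonicity turns a comparison of F (c * h) with y * F h into a comparison
of c * K t with K (y * t), for t = F h. *)
Lemma RV_inverse F rho : RV rho F -> 0 < rho ->
  (forall a c, 0 < a -> a < c -> F a < F c) ->
  (forall M, exists2 h, 0 < h & M < F h) ->
  exists2 K, RV rho^-1 K & forall t, 0 < t -> 0 < K t /\ F (K t) = t.
Proof.
move=> Frho rho0 Finc Funb.
have Flt a c : 0 < c -> F a < F c -> a < c.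
  by move=> c0; apply: contraTT; rewrite -!leNgt le_eqVlt => /predU1P[->//|ca];
     exact/ltW/Finc.
have sol t : exists h, 0 < t -> 0 < h /\ F h = t.
  have [t0|t0] := ltP 0 t; last by exists 0.
  have [d d0 dP] := RV_cvg0 Frho rho0 t0.
  have [c c0 tc] := Funb t.
  have d20 : 0 < d / 2 by rewrite divr_gt0.
  have Fd : F (d / 2) < t by apply: dP; rewrite d20/= ltr_pdivrMr// ltr_pMr// ltr1n.
  have dc : d / 2 <= c by apply/ltW/Flt => //; exact: lt_trans tc.
  have [|h + Fh] := IVT dc (RV_within Frho d20) (v := t).
    by rewrite ge_min le_max (ltW Fd) (ltW tc) orbT.
  by rewrite in_itv/= => /andP[dh _]; exists h => _; rewrite (lt_le_trans d20 dh).
have [K KP] := choice sol.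
have K0 t : 0 < t -> 0 < K t by move=> /KP[].
have FK t : 0 < t -> F (K t) = t by move=> /KP[].
exists K => //; apply: RV_intro => //.
- move=> t; rewrite in_itv/= andbT => t0; apply/cvgrPdist_le => e e0.
  pose e' := Num.min e (K t / 2).
  have Kt := K0 _ t0.
  have e'0 : 0 < e' by rewrite lt_min e0 divr_gt0.
  have e'e : e' <= e by rewrite ge_min lexx.
  have e'K : e' <= K t / 2 by rewrite ge_min lexx orbT.
  have at_ : F (K t - e') < t by rewrite -[ltRHS](FK _ t0); apply: Finc; lra.
  have tc : t < F (K t + e') by rewrite -[ltLHS](FK _ t0); apply: Finc; lra.
  have a0 : 0 < F (K t - e') by apply: (RV_gt0 Frho); lra.
  have idt : u @[u --> t] --> t by exact: cvg_id.
  near=> u; have u0 : 0 < u.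
    by near: u; exact: (cvgr_gt t idt).
  have au : F (K t - e') < F (K u).
    by rewrite FK//; near: u; exact: (cvgr_gt t idt).
  have uc : F (K u) < F (K t + e').
    by rewrite FK//; near: u; exact: (cvgr_lt t idt).
  have ? := Flt _ _ (K0 _ u0) au.
  have ? : K u < K t + e' by apply: Flt uc; lra.
  by rewrite ler_distl; apply/andP; split; lra.
- move=> y lo hi y0 lo0 loy yhi.
  have hi0 : 0 < hi by apply: lt_trans yhi; rewrite powR_gt0.
  have yK : (y `^ rho^-1) `^ rho = y by rewrite -powRrM mulVf ?gt_eqF// powRr1// ltW.
  have lorho : lo `^ rho < y.
    by rewrite -[ltRHS]yK gt0_ltr_powR// nnegrE ?powR_ge0// ltW.
  have hirho : y < hi `^ rho.
    by rewrite -[ltLHS]yK gt0_ltr_powR// nnegrE ?powR_ge0// ltW.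
  have [d1 d10 d1P] := RV_ratio Frho lo0 (lt_le_trans (ltrN10 _) (powR_ge0 _ _)) lorho.
  have [d2 d20 d2P] := RV_ratio Frho hi0 hirho (ltr_pwDr ltr01 (lexx _)).
  pose d := Num.min d1 d2; have d0 : 0 < d by rewrite lt_min d10.
  exists (F d) => [|t /andP[t0 td]]; first exact: (RV_gt0 Frho).
  have Kt : K t < d by apply: Flt => //; rewrite FK.
  move: Kt; rewrite lt_min => /andP[Kd1 Kd2].
  have yt0 : 0 < y * t by rewrite mulr_gt0.
  have /andP[_ l] := d1P _ (introT andP (conj (K0 _ t0) Kd1)).
  have /andP[u _] := d2P _ (introT andP (conj (K0 _ t0) Kd2)).
  apply/andP; split; apply/ltW/Flt; rewrite ?(FK _ yt0) ?mulr_gt0 ?K0//.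
    by rewrite (FK _ t0) in l.
  by rewrite (FK _ t0) in u.
Unshelve. all: by end_near. Qed.

(** The ratio K (y * t) / K t converges to y `^ a without being equal to it. As V
is monotone, V (K (y * t)) lies between V (z1 * K t) and V (z2 * K t) for fixed
z1 and z2 on either side of y `^ a. *)
Lemma RV_comp V K c a : RV c V -> RV a K -> 0 < a ->
  (forall x y, 0 < x -> x <= y -> V x <= V y) ->
  RV (a * c) (V \o K).
Proof.
move=> Vc Ka a0 Vnd; apply: RV_intro.
- move=> t; rewrite in_itv/= andbT => t0.
  apply: continuous_comp; first exact: (RV_continuous Ka).
  exact/(RV_continuous Vc)/(RV_gt0 Ka).
- by move=> t t0; exact/(RV_gt0 Vc)/(RV_gt0 Ka).
move=> y lo hi y0 lo0; rewrite powRrM; set z := y `^ a => loz zhi.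
have z0 : 0 < z by rewrite powR_gt0.
have pc := @continuous_powRl c z z0.
have [z1 z10 [z1z lo1]] : exists2 z1, 0 < z1 & z1 < z /\ lo < z1 `^ c.
  near z^'- => z1; exists z1; last split; near: z1.
  - exact: nbhs_left_gt.
  - exact: nbhs_left_lt.
  - by apply: cvgr_gt loz; apply: cvg_at_left_filter; exact: pc.
have [z2 zz2 hi2] : exists2 z2, z < z2 & z2 `^ c < hi.
  near z^'+ => z2; exists z2; near: z2.
  - exact: nbhs_right_gt.
  - by apply: cvgr_lt zhi; apply: cvg_at_right_filter; exact: pc.
have z20 : 0 < z2 by exact: lt_trans zz2.
have [d1 d10 d1P] := RV_ratio Vc z10 lo1 (ltr_pwDr ltr01 (lexx _)).
have [d2 d20 d2P] := RV_ratio Vc z20 (lt_le_trans (ltrN10 _) (powR_ge0 _ _)) hi2.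
have [d3 d30 d3P] := RV_ratio Ka y0 z1z zz2.
have [d4 d40 d4P] := RV_cvg0 Ka a0 d10.
have [d5 d50 d5P] := RV_cvg0 Ka a0 d20.
exists (Num.min d3 (Num.min d4 d5)) => [|t]; first by rewrite !lt_min d30 d40.
rewrite !lt_min => /andP[t0 /andP[t3 /andP[t4 t5]]].
have K0 := RV_gt0 Ka t0.
have /andP[/ltW l3 /ltW u3] := d3P t (introT andP (conj t0 t3)).
have K1 := d4P t (introT andP (conj t0 t4)).
have K2 := d5P t (introT andP (conj t0 t5)).
have /andP[/ltW l1 _] := d1P _ (introT andP (conj K0 K1)).
have /andP[_ /ltW u2] := d2P _ (introT andP (conj K0 K2)).
rewrite /comp; apply/andP; split.
  by apply: le_trans l1 _; apply: Vnd => //; rewrite mulr_gt0.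
by apply: le_trans u2; apply: Vnd => //; apply: (RV_gt0 Ka); rewrite mulr_gt0.
Unshelve. all: by end_near. Qed.

End regular_variation.

(** * Affine changes of variable *)

Section lebesgue_affine.
Context (R : realType).
Local Notation leb := (@lebesgue_measure R).
Local Open Scope ereal_scope.

(** Lebesgue measure is determined by half-open intervals, on which the image by
an affine map is explicit. *)
Lemma ge0_integral_affine (a y : R) (f : R -> \bar R) : (0 < y)%R ->
  measurable_fun [set: measurableTypeR R] f -> (forall x, 0 <= f x) ->
  \int[leb]_x f x = y%:E * \int[leb]_x f (y * x + a)%R.
Proof.
move=> y0 mf f0; have y0' : (0 <= y)%R by exact: ltW.
pose aff (x : measurableTypeR R) : measurableTypeR R := (y * x + a)%R.
have maff : measurable_fun setT aff.
  by apply: measurable_funD => //; exact: measurable_funM.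
have [m mE] : exists m : {measure set (measurableTypeR R) -> \bar R},
    (forall A, m A = leb (aff @^-1` A)) /\ \int[m]_x f x = \int[leb]_x f (aff x).
  unshelve refine (ex_intro _ (pushforward leb aff :
    {measure set (measurableTypeR R) -> \bar R}) _); first exact: maff.
  split; first by move=> A; reflexivity.
  exact: (ge0_integral_pushforward maff leb measurableT mf (fun x _ => f0 x)).
rewrite -mE.2 -(ge0_integral_mscale m measurableT (NngNum y0'))//.
apply: eq_measure_integral => A mA _.
apply: lebesgue_measure_unique => // _ [[u v]] _ <-.
rewrite -[RHS]/(y%:E * m `]u, v]%classic) mE.1.
rewrite (_ : _ @^-1` _ = `]((u - a) / y)%R, ((v - a) / y)%R]%classic); last first.
  apply/seteqP; split => x /=; rewrite !in_itv/= ltr_pdivrMr// ler_pdivlMr//;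
    by rewrite ltrBlDr lerBrDr (mulrC x).
rewrite !lebesgue_measure_itv/= !lte_fin ltr_pM2r ?invr_gt0// ltrBlDr subrK.
case: ifPn => _; last by rewrite mule0.
by rewrite -!EFinD -EFinM; congr EFin; field; rewrite gt_eqF.
Qed.

Lemma ge0_integral_oppr (f : R -> \bar R) :
  measurable_fun [set: measurableTypeR R] f -> (forall x, 0 <= f x) ->
  \int[leb]_x f x = \int[leb]_x f (- x)%R.
Proof.
move=> mf f0.
have mm : measurable_fun [set: measurableTypeR R] (-%R : _ -> measurableTypeR R) by [].
transitivity (\int[pushforward leb (-%R : _ -> measurableTypeR R)]_x f x).
  by apply: eq_measure_integral => A mA _; apply/esym; exact: lebesgue_measureN.
exact: ge0_integral_pushforward.
Qed.

End lebesgue_affine.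

(** * Mass of the design near the point of estimation *)

Section cumulative.
Context (R : realType).
Local Notation leb := (@lebesgue_measure R).
Variables (beta : R) (nu : R -> R).
Hypothesis nubeta : RV beta nu.

Definition cumul (h : R) : R := \int[leb]_(t in `]0, h]) nu t.

Lemma measurable_RV (D : set R) : measurable D -> D `<=` `]0, +oo[ ->
  measurable_fun D nu.
Proof.
move=> mD D0; apply: (measurable_funS _ D0) => //.
apply: open_continuous_measurable_fun => // x.
by rewrite inE/= in_itv/= andbT; exact: (RV_continuous nubeta).
Qed.

Lemma RV_restrict_ge0 (D : set R) t : D `<=` `]0, +oo[ ->
  (0 <= ((EFin \o nu) \_ D) t)%E.
Proof.
move=> D0; rewrite patchE; case: ifPn => // /set_mem/D0 /=.
by rewrite in_itv/= andbT lee_fin => /(RV_gt0 nubeta)/ltW.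
Qed.

Lemma integral_scale (y h : R) : 0 < y ->
  (\int[leb]_(t in `]0%R, (y * h)%R]) (nu t)%:E =
   y%:E * \int[leb]_(t in `]0%R, h]) (nu (y * t))%:E)%E.
Proof.
move=> y0; have D0 (b : R) : `]0, b] `<=` (`]0, +oo[ : set R).
  by move=> t /=; rewrite !in_itv/= andbT => /andP[].
rewrite integral_mkcond (ge0_integral_affine 0 y0)//; last 2 first.
- apply/(measurable_restrictT _ _).1 => //.
  by apply/measurable_EFinP; exact: measurable_RV.
- by move=> x; exact: RV_restrict_ge0.
congr (_ * _)%E; rewrite [RHS]integral_mkcond; apply: eq_integral => t _.
rewrite addr0 !patchE /= !mem_setE !in_itv/=.
by rewrite pmulr_rgt0// ler_pM2l.
Qed.

Hypothesis nuint : exists2 d, 0 < d &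
  (\int[leb]_(t in `]0%R, d]) (nu t)%:E < +oo)%E.

Lemma cumul_integrable (h : R) : leb.-integrable `]0, h] (EFin \o nu).
Proof.
have sub (b : R) : `]0, b] `<=` (`]0, +oo[ : set R).
  by move=> t /=; rewrite !in_itv/= andbT => /andP[].
have [d d0 nud] := nuint.
have intd : leb.-integrable `]0, d] (EFin \o nu).
  apply/integrableP; split.
    by apply/measurable_EFinP; apply: measurable_RV.
  apply: le_lt_trans nud; rewrite le_eqVlt; apply/orP; left; apply/eqP.
  apply: eq_integral => t; rewrite inE/= in_itv/= => /andP[t0 _].
  by rewrite gtr0_norm// (RV_gt0 nubeta).
have [hd|dh] := leP h d.
  apply: integrableS intd => //; apply: subset_itvl.
  by rewrite bnd_simp.
have intcc : leb.-integrable `[d, h] (EFin \o nu).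
  apply: continuous_compact_integrable; first exact: segment_compact.
  exact: (RV_within nubeta).
have intdh : leb.-integrable `]d, h] (EFin \o nu).
  by apply: integrableS intcc => //; exact: subset_itv_oc_cc.
have Ue : `]0, h]%classic = `]0, d]%classic `|` `]d, h]%classic :> set R.
  by rewrite -itv_bndbnd_setU// bnd_simp// ltW.
have mnu : measurable_fun `]0, h] nu by apply: measurable_RV => //; exact: sub.
rewrite Ue; apply/integrableP; split; first by rewrite -Ue; exact/measurable_EFinP.
rewrite ge0_integral_setU//=.
- by move/integrableP : intd => [_ ?]; move/integrableP : intdh => [_ ?]; exact: lte_add_pinfty.
- by rewrite -Ue; apply/measurable_EFinP; exact: measurableT_comp.
- rewrite disj_set2E; apply/eqP; rewrite -subset0 => t [] /=.
  rewrite !in_itv/= => /andP[_ td] /andP[dt _].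
  by move: (lt_le_trans dt td); rewrite ltxx.
Qed.

Lemma cumulE (h : R) :
  (cumul h)%:E = (\int[leb]_(t in `]0%R, h]) (nu t)%:E)%E.
Proof.
by rewrite /cumul/Rintegral fineK//; exact/integrable_fin_num/cumul_integrable.
Qed.

Lemma cumulB (a b : R) : 0 <= a -> a <= b ->
  (cumul b - cumul a)%:E = (\int[leb]_(t in `]a, b]) (nu t)%:E)%E.
Proof.
move=> a0 ab; rewrite /cumul Rintegral_itvB ?bnd_simp//.
  rewrite /Rintegral fineK//; apply: integrable_fin_num => //.
  apply: integrableS (cumul_integrable b) => //.
  by apply: subset_itvr; rewrite bnd_simp.
exact: cumul_integrable.
Qed.

Lemma cumul_nd (a b : R) : 0 < a -> a <= b -> cumul a <= cumul b.
Proof.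
move=> a0 ab; rewrite -subr_ge0 -lee_fin cumulB ?(ltW a0)//.
apply: integral_ge0 => t; rewrite /= in_itv/= => /andP[at_ _].
by rewrite lee_fin ltW// (RV_gt0 nubeta)// (lt_trans a0).
Qed.

Lemma cumul0 : cumul 0 = 0.
Proof. by rewrite /cumul set_itvoc0 Rintegral_set0. Qed.

Lemma cumul_gt0 (h : R) : 0 < h -> 0 < cumul h.
Proof.
move=> h0; have h2 : 0 < h / 2 by rewrite divr_gt0.
have hh : h / 2 <= h by lra.
have [c + cP] := EVT_min hh (RV_within nubeta h2 (c := h)).
rewrite in_itv/= => /andP[c0 _].
have nc : 0 < nu c by apply: (RV_gt0 nubeta); lra.
apply: (@lt_le_trans _ _ (nu c * (h / 2))); first exact: mulr_gt0.
have c2 : 0 <= cumul (h / 2).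
  rewrite -lee_fin cumulE; apply: integral_ge0 => t.
  by rewrite /= in_itv/= lee_fin => /andP[/(RV_gt0 nubeta)/ltW].
suff : nu c * (h / 2) <= cumul h - cumul (h / 2) by lra.
rewrite -lee_fin (cumulB (ltW h2) hh).
have -> : (nu c * (h / 2))%:E = (\int[leb]_(t in `](h / 2)%R, h]) (cst (nu c)%:E t))%E.
  rewrite integral_cst//= lebesgue_measure_itv/= lte_fin ifT; last by lra.
  by rewrite -EFinB -EFinM; congr (_ * _)%:E; lra.
apply: ge0_le_integral => //.
- by move=> t _; rewrite lee_fin ltW.
- apply/measurable_EFinP; apply: measurable_RV => // t /=.
  by rewrite !in_itv/= andbT => /andP[+ _]; exact: lt_trans.
- move=> t; rewrite /= in_itv/= lee_fin => /andP[ht th].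
  by apply: cP; rewrite in_itv/= th ltW.
Qed.

Lemma cumul_continuous (h : R) : 0 < h -> {for h, continuous cumul}.
Proof.
move=> h0; apply/differentiable_continuous/derivable1_diffP.
have hh : h < h + 1 by rewrite ltrDl.
have [] // := @continuous_FTC1 R nu (BRight 0) h (h + 1) hh (cumul_integrable _).
exact: (RV_continuous nubeta).
Qed.

(** After a change of variable V (y * h) is y times the integral of nu (y * t)
over ]0, h], where the ratio bounds for nu hold at every t. This also covers
beta = -1, for which V is slowly varying. *)
Lemma cumul_RV : RV (beta + 1) cumul.
Proof.
apply: RV_intro.
- by move=> h; rewrite in_itv/= andbT; exact: cumul_continuous.
- exact: cumul_gt0.
move=> y lo hi y0 lo0 loy yhi.
have yb : y `^ (beta + 1) = y `^ beta * y.
  by rewrite powRD ?powRr1 ?ltW// (gt_eqF y0) implybT.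
have loy' : lo / y < y `^ beta by rewrite ltr_pdivrMr// -yb.
have yhi' : y `^ beta < hi / y by rewrite ltr_pdivlMr// -yb.
have [d d0 dP] := RV_ratio nubeta y0 loy' yhi'.
exists d => // h /andP[h0 hd].
have intC (k : R) : ((k * cumul h)%:E =
    y%:E * \int[leb]_(t in `]0%R, h]) ((k / y * nu t)%:E))%E.
  under eq_integral do rewrite EFinM.
  rewrite integralZl//; last exact: cumul_integrable.
  rewrite -cumulE -!EFinM; congr EFin; field; exact: lt0r_neq0.
have mnu : measurable_fun `]0, h] nu.
  by apply: measurable_RV => // t /=; rewrite !in_itv/= andbT => /andP[].
have mnuy : measurable_fun `]0, h] (fun t => nu (y * t)).
  have sub0 : `]0, h] `<=` (`]0, +oo[ : set R).
    by move=> t /=; rewrite !in_itv/= andbT => /andP[].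
  apply: (measurable_funS _ sub0) => //.
  apply: open_continuous_measurable_fun => // x.
  rewrite inE/= in_itv/= andbT => xp.
  apply: (@continuous_comp _ _ _ (fun t => y * t) nu).
    by apply: mulrl_continuous.
  by apply: (RV_continuous nubeta); exact: mulr_gt0.
rewrite -!lee_fin !intC cumulE integral_scale//.
rewrite !lee_pmul2l// ?lte_fin//; apply/andP; split;
    apply: ge0_le_integral => //.
- move=> t; rewrite /= in_itv/= => /andP[t0 _].
  by rewrite lee_fin mulr_ge0 ?divr_ge0 ?ltW// (RV_gt0 nubeta).
- by apply/measurable_EFinP; exact: measurable_funM.
- exact/measurable_EFinP.
- move=> t; rewrite /= in_itv/= => /andP[t0 th].
  by rewrite lee_fin; have /andP[/ltW] := dP t (introT andP (conj t0 (le_lt_trans th hd))).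
- move=> t; rewrite /= in_itv/= => /andP[t0 _].
  by rewrite lee_fin ltW// (RV_gt0 nubeta)// mulr_gt0.
- exact/measurable_EFinP.
- by apply/measurable_EFinP; exact: measurable_funM.
- move=> t; rewrite /= in_itv/= => /andP[t0 th].
  by rewrite lee_fin; have /andP[_ /ltW] := dP t (introT andP (conj t0 (le_lt_trans th hd))).
Qed.

End cumulative.

Section design_intervals.
Context (R : realType).
Local Notation leb := (@lebesgue_measure R).
Variables (beta : R) (nu : R -> R) (x0 r : R) (mu : design_density R).
Hypothesis nubeta : RV beta nu.
Hypothesis mu_nu : forall x, 0 < `|x - x0| < r -> mu x = nu `|x - x0|.

Let restrict_mu (D : set R) : measurable D ->
  measurable_fun [set: measurableTypeR R] ((EFin \o mu) \_ D) /\
  forall x, (0 <= ((EFin \o mu) \_ D) x)%E.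
Proof.
move=> mD; split.
  apply/(measurable_restrictT _ _).1 => //; apply: measurable_funTS.
  by apply/measurable_EFinP; exact: design_measurable.
by move=> x; rewrite patchE; case: ifPn => // _; rewrite lee_fin design_ge0.
Qed.

Lemma integral_design_right (a b : R) : 0 <= a -> b < r ->
  (\int[leb]_(x in `](x0 + a)%R, (x0 + b)%R]) (mu x)%:E =
   \int[leb]_(t in `]a, b]) (nu t)%:E)%E.
Proof.
move=> a0 br; rewrite integral_mkcond.
have [mD D0] := restrict_mu (measurable_itv `]x0 + a, x0 + b]).
rewrite (ge0_integral_affine x0 (@ltr01 R))// mul1e [RHS]integral_mkcond.
apply: eq_integral => t _; rewrite !patchE/= !mem_setE !in_itv/= mul1r.
rewrite [t + x0]addrC ltrD2l lerD2l; case: ifPn => // /andP[at_ tb].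
have t0 : 0 < t by exact: le_lt_trans at_.
have e : x0 + t - x0 = t by rewrite addrAC subrr add0r.
by rewrite mu_nu e ?gtr0_norm// t0 (le_lt_trans tb).
Qed.

Lemma integral_design_left (b : R) : b < r ->
  (\int[leb]_(x in `[(x0 - b)%R, x0]) (mu x)%:E =
   \int[leb]_(t in `]0%R, b]) (nu t)%:E)%E.
Proof.
move=> br; rewrite -integral_itv_bndo_bndc; last first.
  by apply: measurable_funTS; apply/measurable_EFinP; exact: design_measurable.
rewrite integral_mkcond.
have [mD D0] := restrict_mu (measurable_itv `[x0 - b, x0[).
rewrite ge0_integral_oppr// (ge0_integral_affine (- x0) (@ltr01 R))//; last first.
  by apply: (measurableT_comp mD).
rewrite mul1e [RHS]integral_mkcond.
apply: eq_integral => t _; rewrite !patchE/= !mem_setE !in_itv/= mul1r.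
rewrite opprB lerD2l lerN2 gtrDl oppr_lt0 andbC; case: ifPn => // /andP[t0 tb].
have e : x0 - t - x0 = - t by rewrite addrAC subrr add0r.
by rewrite mu_nu e ?normrN ?gtr0_norm// t0 (le_lt_trans tb).
Qed.

(** The mass of mu bounds the integral of nu, even for beta = -1, where regular
variation alone does not make nu integrable. *)
Lemma design_integrable : 0 < r -> exists2 d, 0 < d &
  (\int[leb]_(t in `]0%R, d]) (nu t)%:E < +oo)%E.
Proof.
move=> r0; exists (r / 2); first by rewrite divr_gt0.
rewrite -integral_design_right//; last by rewrite ltr_pdivrMr// ltr_pMr// ltr1n.
apply: (@le_lt_trans _ _ 1%E); last exact: ltry.
rewrite -(design_integral mu); apply: ge0_subset_integral => //.
  by apply/measurable_EFinP; exact: design_measurable.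
by move=> x _; rewrite lee_fin design_ge0.
Qed.

Lemma design_law_right (a b : R) : 0 <= a -> a <= b -> b < r ->
  design_law mu `]x0 + a, x0 + b] = (cumul nu b - cumul nu a)%:E.
Proof.
move=> a0 ab br; rewrite /design_law integral_design_right//.
rewrite (cumulB nubeta)//; apply: design_integrable.
by apply: le_lt_trans br; exact: le_trans ab.
Qed.

Lemma design_law_window (b : R) : 0 < b -> b < r ->
  (design_law mu `[(x0 - b)%R, (x0 + b)%R] <= (2 * cumul nu b)%:E)%E.
Proof.
move=> b0 br; have r0 : 0 < r by exact: lt_trans br.
have -> : `[x0 - b, x0 + b]%classic = `[x0 - b, x0] `|` `]x0 + 0, x0 + b].
  rewrite addr0; apply/seteqP; split => t /=; rewrite !in_itv/=.
    by move=> /andP[-> ->]; rewrite andbT; have [?|?] := leP t x0; [left|right].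
  by move=> [/andP[? ?]|/andP[? ?]]; apply/andP; split; lra.
apply: le_trans (measureU2 _ _ _) _ => //.
rewrite -[leLHS]/(design_law mu `[(x0 - b)%R, x0]%classic +
  design_law mu `](x0 + 0)%R, (x0 + b)%R]%classic)%E.
rewrite design_law_right// ?(ltW b0)// cumul0 subr0 mulr_natl mulr2n EFinD.
rewrite leeD2r// /design_law integral_design_left// (cumulE nubeta)//.
exact: design_integrable.
Qed.

End design_intervals.

(** * The bandwidth *)

Lemma near_natr_gt (R : realType) (x : R) : \forall n \near \oo, x < n%:R.
Proof. exact: nbhs_infty_gtr. Qed.

Section bandwidth.
Context (R : realType) (s beta : R) (omega nu : R -> R).
Hypotheses (s0 : 0 < s) (beta1 : -1 <= beta).
Hypotheses (omegas : RV s omega) (nubeta : RV beta nu).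
Hypothesis nuint : exists2 d, 0 < d &
  (\int[@lebesgue_measure R]_(t in `]0%R, d]) (nu t)%:E < +oo)%E.

Local Notation V := (cumul nu).
Local Notation rho := (1 + 2 * s + beta).

(** Up to the factor 2 n / sigma^2, the squared ratio of the allowed bias to the
noise of an average over the window of half-width h. *)
Definition info (h : R) : R := omega h * omega h * V h.

Let V0 h : 0 < h -> 0 < V h. Proof. exact: cumul_gt0 nubeta nuint h. Qed.
Let om0 h : 0 < h -> 0 < omega h. Proof. exact: RV_gt0 omegas. Qed.

Lemma rho_gt0 : 0 < rho. Proof. by move: s0 beta1; lra. Qed.

Lemma info_RV : RV rho info.
Proof.
have -> : rho = s + s + (beta + 1) by lra.
exact: (RV_mul (RV_mul omegas omegas) (cumul_RV nubeta nuint)).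
Qed.

Lemma bandwidthP sigma n h : 0 < sigma -> (0 < n)%N -> 0 < h ->
  bandwidth_equation sigma omega nu n h <-> info h = sigma ^+ 2 / (2 * n%:R).
Proof.
move=> sg0 n0 h0; rewrite /bandwidth_equation -/(cumul nu h) /info.
have Vh := V0 h0; have oh := om0 h0; have nR : 0 < n%:R :> R by rewrite ltr0n.
have q0 : 0 < 2 * n%:R * V h by rewrite !mulr_gt0.
have sq := sqr_sqrtr (ltW q0); have sq0 : 0 < Num.sqrt (2 * n%:R * V h).
  by rewrite sqrtr_gt0.
split=> [->|e].
  rewrite -[_ / _ * _]expr2 expr_div_n sq; field.
  by rewrite !gt_eqF.
apply/eqP; rewrite -(@eqrXn2 _ 2) ?divr_ge0 ?(ltW oh) ?(ltW sg0) ?(ltW sq0)//.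
rewrite expr_div_n sq; apply/eqP.
have -> : omega h ^+ 2 = info h / V h by rewrite /info mulfK ?gt_eqF// expr2.
by rewrite /info e; field; rewrite !gt_eqF.
Qed.

(** If [info] exceeded its value at h before h, it would have taken that value
earlier, by the intermediate value theorem: it tends to 0 at 0. *)
Lemma running_sup_bandwidth sigma n h : 0 < sigma -> (0 < n)%N ->
  smallest_bandwidth sigma omega nu n h ->
  running_sup info h = sigma ^+ 2 / (2 * n%:R).
Proof.
move=> sg0 n0 [h0 /(bandwidthP sg0 n0 h0) Gh min].
have iRV := info_RV; have r0 := rho_gt0.
apply/eqP; rewrite eq_le; apply/andP; split; last first.
  by rewrite -Gh; apply: (le_running_sup iRV r0); rewrite h0 lexx.
apply: (running_sup_le iRV r0) => // t /andP[t0 th].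
have [//|tau] := leP (info t) (sigma ^+ 2 / (2 * n%:R)).
have tau0 : 0 < sigma ^+ 2 / (2 * n%:R) :> R.
  by rewrite divr_gt0 ?exprn_gt0// mulr_gt0// ltr0n.
have [d d0 dP] := RV_cvg0 iRV r0 tau0.
pose a := Num.min (d / 2) (t / 2).
have a0 : 0 < a by rewrite lt_min !divr_gt0.
have ad : a <= d / 2 by rewrite ge_min lexx.
have at_ : a <= t / 2 by rewrite ge_min lexx orbT.
have Ga : info a < sigma ^+ 2 / (2 * n%:R) by apply: dP; apply/andP; split; lra.
have le_at : a <= t by lra.
have [|c] := IVT le_at (RV_within iRV a0) (v := sigma ^+ 2 / (2 * n%:R)).
  by rewrite ge_min le_max (ltW Ga) (ltW tau) orbT.
rewrite in_itv/= => /andP[ac ct] Gc; have c0 : 0 < c by exact: lt_le_trans ac.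
have hc := min _ c0 ((bandwidthP sg0 n0 c0).2 Gc).
have eht : h = t by apply/eqP; rewrite eq_le th andbT (le_trans hc ct).
by rewrite -eht Gh ltxx in tau.
Qed.

Lemma bandwidth_cvg0 sigma (h : nat -> R) : 0 < sigma ->
  (\forall n \near \oo, smallest_bandwidth sigma omega nu n (h n)) ->
  forall e, 0 < e -> \forall n \near \oo, 0 < h n < e.
Proof.
move=> sg0 hn e e0.
have iRV := info_RV; have r0 := rho_gt0.
have Ge := RV_gt0 iRV e0.
near=> n; have n0 : (0 < n)%N by near: n; exact: nbhs_infty_gt.
have nR : 0 < n%:R :> R by rewrite ltr0n.
have hb : smallest_bandwidth sigma omega nu n (h n) by near: n.
have [h0 _ _] := hb; rewrite h0/= ltNge; apply/negP => eh.
have := running_sup_bandwidth sg0 n0 hb => E.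
have : info e <= sigma ^+ 2 / (2 * n%:R).
  by rewrite -E; apply: (le_running_sup iRV r0); rewrite e0.
have : sigma ^+ 2 / (2 * info e) < n%:R by near: n; exact: near_natr_gt.
rewrite (ltr_pdivrMr _ _ (mulr_gt0 (ltr0Sn _ 1) Ge)) => lt1.
by rewrite (ler_pdivlMr _ _ (mulr_gt0 (ltr0Sn _ 1) nR)) => le1; lra.
Unshelve. all: by end_near. Qed.

(** The factor 1 + h makes the running maximum strictly increasing and unbounded,
hence invertible, and does not change it near 0. *)
Let F h := (1 + h) * running_sup info h.

Let FRV : RV rho F.
Proof.
rewrite -[rho]add0r; apply: RV_mul; last exact: running_sup_RV info_RV rho_gt0.
split=> [x _|h h0|y y0].
- by apply: cvgD; [exact: cvg_cst|exact: cvg_id].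
- by rewrite addr_gt0.
rewrite powRr0.
have id0 : h @[h --> (0:R)^'+] --> (0 : R) by apply: cvg_at_right_filter; exact: cvg_id.
suff : (1 + y * h) / (1 + h) @[h --> (0:R)^'+] --> (1 + y * 0) / (1 + 0).
  by rewrite mulr0 addr0 divr1.
apply: cvgM; first by apply: cvgD; [exact: cvg_cst|apply: cvgM; [exact: cvg_cst|exact: id0]].
by apply: cvgV; [rewrite addr0|apply: cvgD; [exact: cvg_cst|exact: id0]].
Qed.

Let Finc a c : 0 < a -> a < c -> F a < F c.
Proof.
move=> a0 ac; have c0 : 0 < c by exact: lt_trans ac.
have sa := running_sup_gt0 info_RV rho_gt0 a0.
have sac := running_sup_nd info_RV rho_gt0 a0 (ltW ac).
rewrite /F; apply: (@lt_le_trans _ _ ((1 + c) * running_sup info a)).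
  by rewrite ltr_pM2r// ltrD2l.
by rewrite ler_wpM2l// addr_ge0// ltW.
Qed.

Let Funb M : exists2 h, 0 < h & M < F h.
Proof.
have s1 := running_sup_gt0 info_RV rho_gt0 (@ltr01 R).
set g1 := running_sup info 1 in s1.
exists (Num.max 1 (M / g1)); first by rewrite lt_max ltr01.
set h := Num.max _ _; have h1 : 1 <= h by rewrite le_max lexx.
have hM : M / g1 <= h by rewrite le_max lexx orbT.
have sh := running_sup_nd info_RV rho_gt0 (@ltr01 R) h1; rewrite -/g1 in sh.
apply: (@lt_le_trans _ _ ((1 + h) * g1)).
  by move: hM; rewrite ler_pdivrMr// => /le_lt_trans; apply; rewrite ltr_pM2r// ltrDr.
by rewrite ler_wpM2l// addr_ge0//; lra.
Qed.

(** With W = V o K, the bandwidth lies between K (sigma^2 / (2n)) and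
K (sigma^2 / n), hence V (h n) lies between two values of W whose ratios to
W (1 / n) converge to powers of sigma^2 / 2 and of sigma^2. As omega (h n) is
the square root of sigma^2 / (2 n V (h n)), the function l has to be the square
root of t / W t divided by the power t `^ (s / rho). *)
Lemma rate_function : exists2 l : R -> R, RV 0 l &
  forall sigma (h : nat -> R), 0 < sigma ->
  (\forall n \near \oo, smallest_bandwidth sigma omega nu n (h n)) ->
  \forall n \near \oo,
    sigma `^ (2 * s / rho) * n%:R `^ (- (s / rho)) * l (n%:R^-1) / 2 <=
      omega (h n) <=
    2 * (sigma `^ (2 * s / rho) * n%:R `^ (- (s / rho)) * l (n%:R^-1)).
Proof.
have r0 := rho_gt0.
have [K KRV KP] := RV_inverse FRV r0 Finc Funb.
have VRV := cumul_RV nubeta nuint.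
have Vnd := cumul_nd nubeta nuint.
pose W := V \o K.
pose kap := rho^-1 * (beta + 1).
have WRV : RV kap W by apply: RV_comp => //; rewrite invr_gt0.
have W0 t : 0 < t -> 0 < W t by exact: RV_gt0 WRV.
pose l t := t `^ (- (s / rho)) * (t * W t `^ (-1)) `^ 2^-1.
exists l.
  have -> : 0 = 1 * (- (s / rho)) + (1 + kap * (-1)) * 2^-1 :> R.
    by rewrite /kap; field; rewrite gt_eqF.
  exact: (RV_mul (RV_pow _ (@RV_id R)) (RV_pow _ (RV_mul (@RV_id R) (RV_pow _ WRV)))).
move=> sigma h sg0 hn.
(* K (y1 / n) <= h n <= K (y2 / n) as soon as h n <= 1 *)
pose y1 := sigma ^+ 2 / 2; pose y2 := sigma ^+ 2.
have y10 : 0 < y1 by rewrite divr_gt0// exprn_gt0.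
have y20 : 0 < y2 by rewrite exprn_gt0.
have pk y : 0 < y -> 0 < y `^ kap by exact: powR_gt0.
have [d1 d10 d1P] : exists2 d, 0 < d & forall t, 0 < t < d ->
    y1 `^ kap / 2 * W t < W (y1 * t) < (y1 `^ kap + 1) * W t.
  by apply: (RV_ratio WRV) => //; have := pk _ y10; lra.
have [d2 d20 d2P] : exists2 d, 0 < d & forall t, 0 < t < d ->
    -1 * W t < W (y2 * t) < (2 * y2 `^ kap) * W t.
  by apply: (RV_ratio WRV) => //; have := pk _ y20; lra.
have hsmall := bandwidth_cvg0 sg0 hn (@ltr01 R).
near=> n.
set v := sigma `^ _ * _ * _.
have n0 : (0 < n)%N by near: n; exact: nbhs_infty_gt.
have nR : 0 < n%:R :> R by rewrite ltr0n.
have hb : smallest_bandwidth sigma omega nu n (h n) by near: n.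
have [hn0 heq _] := hb.
have hn1 : h n <= 1.
  have /andP[_ /ltW//] : 0 < h n < 1.
  by near: n; exact: hsmall.
have Gs := running_sup_bandwidth sg0 n0 hb.
have Ginfo := (bandwidthP sg0 n0 hn0).1 heq.
pose t : R := n%:R^-1.
have t0 : 0 < t by rewrite invr_gt0.
have td1 : 0 < t < d1.
  have dn : d1^-1 < n%:R by near: n; exact: near_natr_gt.
  by rewrite t0 /t invf_plt.
have td2 : 0 < t < d2.
  have dn : d2^-1 < n%:R by near: n; exact: near_natr_gt.
  by rewrite t0 /t invf_plt.
have tauE : sigma ^+ 2 / (2 * n%:R) = y1 * t by rewrite /y1 /t invfM mulrA.
have y1t : 0 < y1 * t by rewrite mulr_gt0.
have y2t : 0 < y2 * t by rewrite mulr_gt0.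
have [K10 FK1] := KP _ y1t; have [K20 FK2] := KP _ y2t.
have y21 : y2 * t = 2 * (y1 * t) by rewrite /y1 /y2; field.
have Fh : F (h n) = (1 + h n) * (y1 * t) by rewrite /F Gs tauE.
have K1h : K (y1 * t) <= h n.
  rewrite leNgt; apply/negP => /(Finc hn0); rewrite FK1 Fh ltNge => /negP; apply.
  by rewrite ler_peMl ?(ltW y1t)// lerDl ltW.
have hK2 : h n <= K (y2 * t).
  rewrite leNgt; apply/negP => /(Finc K20); rewrite FK2 Fh ltNge => /negP; apply.
  by rewrite y21 ler_wpM2r ?(ltW y1t)//; lra.
have V1 : W (y1 * t) <= V (h n) by apply: Vnd.
have V2 : V (h n) <= W (y2 * t) by apply: Vnd.
have /andP[/ltW Wlo _] := d1P t td1; have /andP[_ /ltW Whi] := d2P t td2.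
have Wt := W0 t t0; have Vh := V0 hn0; have oh := om0 hn0.
have om2 : omega (h n) ^+ 2 = y1 * t / V (h n).
  by rewrite -tauE -Ginfo /info mulfK ?gt_eqF// expr2.
have v2 : v ^+ 2 = y2 / y2 `^ kap * (t / W t).
  have tE : n%:R `^ (- (s / rho)) = t `^ (s / rho).
    by rewrite /t -[n%:R^-1](powR_inv1 (ltW nR)) -powRrM mulN1r.
  have sq (a : R) : 0 <= a -> (a `^ 2^-1) ^+ 2 = a.
    by move=> a0; rewrite -powR_mulrn ?powR_ge0// -powRrM mulVf// powRr1.
  have vE : v = sigma `^ (2 * s / rho) * (t / W t) `^ 2^-1.
    rewrite /v -/t tE /l powR_inv1 ?(ltW Wt)// powRN -!mulrA; congr (_ * _).
    by rewrite mulrA mulfV ?mul1r// gt_eqF// powR_gt0.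
  rewrite vE exprMn sq ?divr_ge0 ?(ltW t0) ?(ltW Wt)//; congr (_ * _).
  rewrite /y2 -(powR_mulrn 2 (ltW sg0)) -(powR_mulrn 2 (powR_ge0 _ _)).
  rewrite -!powRrM -powRB; last by rewrite (gt_eqF sg0) implybT.
  by congr (_ `^ _); rewrite /kap; field; rewrite gt_eqF.
have kap01 : 0 <= kap <= 1.
  rewrite /kap mulrC divr_ge0 ?(ltW r0)//=; last by move: beta1; lra.
  by rewrite ler_pdivrMr// mul1r; move: s0; lra.
have v0 : 0 <= v by rewrite /v !mulr_ge0 ?powR_ge0.
have y1k : y1 `^ kap * 2 >= y2 `^ kap.
  have -> : y2 = y1 * 2 by rewrite /y1 /y2; field.
  rewrite powRM ?(ltW y10)// ler_wpM2l ?powR_ge0//.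
  rewrite -[leRHS]powRr1//; apply: ler_powR; first by rewrite ler1n.
  by case/andP : kap01.
have k1 := pk _ y10; have k2 := pk _ y20.
apply/andP; split.
  have v20 : 0 <= v / 2 by apply: divr_ge0.
  rewrite -(@ler_pXn2r _ 2) ?nnegrE ?v20 ?(ltW oh)//.
  rewrite expr_div_n v2 om2.
  have -> : y2 / y2 `^ kap * (t / W t) / 2 ^+ 2 =
      y1 * t * (2 * y2 `^ kap * W t)^-1.
    by rewrite /y1 -/y2; field; rewrite !gt_eqF.
  by rewrite ler_wpM2l ?(ltW y1t)// lef_pV2 ?posrE ?mulr_gt0// (le_trans V2).
have v20 : 0 <= 2 * v by apply: mulr_ge0.
rewrite -(@ler_pXn2r _ 2) ?nnegrE ?v20 ?(ltW oh)//.
rewrite exprMn v2 om2.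
apply: (@le_trans _ _ (y1 * t * (y1 `^ kap / 2 * W t)^-1)).
  by rewrite ler_wpM2l ?(ltW y1t)// lef_pV2 ?posrE ?mulr_gt0 ?divr_gt0// (le_trans Wlo).
have -> : y1 * t * (y1 `^ kap / 2 * W t)^-1 = 4 * y2 * (t / W t) * (y1 `^ kap * 2 * 2)^-1.
  by rewrite /y1 -/y2; field; rewrite !gt_eqF.
have -> : 2 ^+ 2 * (y2 / y2 `^ kap * (t / W t)) = 4 * y2 * (t / W t) * (y2 `^ kap)^-1.
  by field; rewrite !gt_eqF.
apply: ler_wpM2l.
  have tW : 0 < t / W t by rewrite divr_gt0.
  by apply/ltW/mulr_gt0 => //; exact: mulr_gt0.
by rewrite lef_pV2 ?posrE ?mulr_gt0//; lra.
Unshelve. all: by end_near. Qed.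

End bandwidth.

(** * Integration against the law of the sample *)

Section product_laws.
Context d (T : measurableType d) (R : realType).
Local Open Scope ereal_scope.

Lemma integral_iid0 (P : probability T R) (F : 0.-tuple T -> \bar R) :
  measurable_fun setT F -> \int[iid_law P 0]_z F z = F [tuple].
Proof. by move=> mF; rewrite integral_dirac// diracT mul1e. Qed.

Lemma integral_iidS (P : probability T R) n (F : n.+1.-tuple T -> \bar R) :
  measurable_fun setT F -> (forall z, 0 <= F z) ->
  \int[iid_law P n.+1]_z F z =
  \int[P]_x \int[iid_law P n]_z F (tcons (x, z)).
Proof.
move=> mF F0; rewrite /= ge0_integral_distribution// fubini_tonelli1//.
  exact: measurableT_comp.
by move=> x; exact: F0.
Qed.

Lemma measurable_prod_tnth n (g : 'I_n -> T -> R) :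
  (forall i, measurable_fun setT (g i)) ->
  measurable_fun setT (fun z : n.-tuple T => \prod_(i < n) g i (tnth z i))%R.
Proof.
move=> mg; apply: measurable_prod => i _.
by apply: measurableT_comp => //; exact: measurable_tnth.
Qed.

Lemma prod_tcons n (g : 'I_n.+1 -> T -> R) x z :
  (\prod_(i < n.+1) g i (tnth (tcons (x, z)) i) =
   g ord0 x * \prod_(i < n) g (lift ord0 i) (tnth z i))%R.
Proof.
rewrite big_ord_recl; congr (_ * _)%R.
by apply: eq_bigr => i _; rewrite /tcons/= tnthS.
Qed.

Lemma integral_iid_prod (P : probability T R) n (g : 'I_n -> T -> R)
    (a : 'I_n -> R) :
  (forall i, measurable_fun setT (g i)) -> (forall i x, (0 <= g i x)%R) ->
  (forall i, \int[P]_x (g i x)%:E = (a i)%:E) ->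
  \int[iid_law P n]_z (\prod_(i < n) g i (tnth z i))%:E =
  (\prod_(i < n) a i)%:E.
Proof.
elim: n g a => [|n IH] g a mg g0 ga.
  rewrite integral_iid0; first by rewrite !big_ord0.
  by apply/measurable_EFinP; exact: measurable_prod_tnth.
rewrite integral_iidS; last 2 first.
- by apply/measurable_EFinP; exact: measurable_prod_tnth.
- by move=> z; rewrite lee_fin; apply: prodr_ge0.
have IHg := IH (fun i => g (lift ord0 i)) (fun i => a (lift ord0 i))
  (fun i => mg _) (fun i => g0 _) (fun i => ga _).
transitivity (\int[P]_x ((g ord0 x)%:E * (\prod_(i < n) a (lift ord0 i))%:E)).
  apply: eq_integral => x _; rewrite -IHg.
  under eq_integral => z _ do rewrite prod_tcons EFinM.
  rewrite ge0_integralZl//; last 3 first.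
  - apply/measurable_EFinP.
    exact: (@measurable_prod_tnth _ (fun i => g (lift ord0 i))).
  - by move=> z _; rewrite lee_fin; apply: prodr_ge0.
  - by rewrite lee_fin.
rewrite ge0_integralZr//; last 3 first.
- exact/measurable_EFinP.
- by move=> x _; rewrite lee_fin.
- rewrite lee_fin; apply: prodr_ge0 => i _.
  by rewrite -lee_fin -ga; apply: integral_ge0 => x _; rewrite lee_fin.
by rewrite ga -EFinM big_ord_recl.
Qed.

(** The likelihood ratio of the sample is the product of those of the
observations. *)
Lemma integral_iid_density (P Q : probability T R) (ell : T -> R) n
    (F : n.-tuple T -> \bar R) :
  measurable_fun setT ell -> (forall x, (0 <= ell x)%R) ->
  (forall g : T -> \bar R, measurable_fun setT g -> (forall x, 0 <= g x) ->
    \int[Q]_x g x = \int[P]_x (g x * (ell x)%:E)) ->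
  measurable_fun setT F -> (forall z, 0 <= F z) ->
  \int[iid_law Q n]_z F z =
  \int[iid_law P n]_z (F z * (\prod_(i < n) ell (tnth z i))%:E).
Proof.
move=> mell ell0 QP; elim: n F => [|n IH] F mF F0.
  rewrite !integral_iid0//; first by rewrite big_ord0 mule1.
  apply: emeasurable_funM => //; apply/measurable_EFinP.
  exact: (@measurable_prod_tnth _ (fun=> ell)).
have mFc : measurable_fun setT (fun u : T * n.-tuple T => F (tcons u)).
  exact: measurableT_comp.
have mprod m : measurable_fun setT (fun z : m.-tuple T =>
    (\prod_(i < m) ell (tnth z i))%:E).
  by apply/measurable_EFinP; exact: (@measurable_prod_tnth _ (fun=> ell)).
have prod0 m (z : m.-tuple T) : 0 <= (\prod_(i < m) ell (tnth z i))%:E.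
  by rewrite lee_fin prodr_ge0.
have mF2 x : measurable_fun setT (fun z : n.-tuple T => F (tcons (x, z))).
  by apply: (measurableT_comp mFc); exact: measurable_pair1.
rewrite !integral_iidS//; last 2 first.
- by apply: emeasurable_funM => //; exact: mprod.
- by move=> z; apply: mule_ge0 => //; exact: prod0.
rewrite QP//; last 2 first.
- exact: (measurable_fun_fubini_tonelli_F (m2 := iid_law Q n)
    (fun u => F (tcons u))).
- by move=> x; exact: integral_ge0.
apply: eq_integral => x _; rewrite IH//.
rewrite -ge0_integralZr//; last 3 first.
- by apply: emeasurable_funM => //; exact: mprod.
- by move=> z _; apply: mule_ge0 => //; exact: prod0.
- by rewrite lee_fin.
apply: eq_integral => z _; rewrite (@prod_tcons _ (fun=> ell)) -muleA -EFinM.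
by rewrite mulrC.
Qed.

End product_laws.

Lemma measurable_section1 d1 d2 d (T1 : measurableType d1)
    (T2 : measurableType d2) (T : measurableType d) (f : T1 * T2 -> T) x :
  measurable_fun setT f -> measurable_fun setT (fun y => f (x, y)).
Proof. by move=> mf; apply: measurableT_comp => //; exact: measurable_pair1. Qed.

Section paired_sample.
Context d1 d2 d (T1 : measurableType d1) (T2 : measurableType d2)
  (T : measurableType d) (R : realType).
Variable phi : {mfun (T1 * T2)%type >-> T}.
Local Open Scope ereal_scope.

Definition zip_with n (x : n.-tuple T1) (y : n.-tuple T2) : n.-tuple T :=
  [tuple phi (tnth x i, tnth y i) | i < n].

Lemma zip_with_tcons n x0 (x : n.-tuple T1) y0 (y : n.-tuple T2) :
  zip_with (tcons (x0, x)) (tcons (y0, y)) =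
  tcons (phi (x0, y0), zip_with x y).
Proof.
apply: eq_from_tnth => i; rewrite tnth_mktuple.
case: (unliftP ord0 i) => [j|] ->; last by [].
by rewrite /tcons/= !tnthS tnth_mktuple.
Qed.

Lemma measurable_zip_with n :
  measurable_fun setT (fun u => @zip_with n u.1 u.2).
Proof.
apply/measurable_fun_tnthP => i /=.
rewrite (_ : _ \o _ = fun u => phi (tnth u.1 i, tnth u.2 i)); last first.
  by apply/funext => u; rewrite /= tnth_mktuple.
apply: measurableT_comp => //; apply: measurable_fun_pair.
  by apply: (measurableT_comp (measurable_tnth i)); exact: measurable_fst.
by apply: (measurableT_comp (measurable_tnth i)); exact: measurable_snd.
Qed.

(** Conditioning on the design: a sample of pairs is integrated by first fixing
all the first components. Each induction step exchanges the integral over the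
new second component with the one over the remaining first components. *)
Lemma integral_iid_zip (P : probability T1 R) (Q : probability T2 R) n
    (F : n.-tuple T -> \bar R) :
  measurable_fun setT F -> (forall z, 0 <= F z) ->
  \int[iid_law (distribution (P \x Q) phi) n]_z F z =
  \int[iid_law P n]_x \int[iid_law Q n]_y F (zip_with x y).
Proof.
elim: n F => [|n IH] F mF F0.
  have mF2 : measurable_fun setT (fun u => F (@zip_with 0 u.1 u.2)).
    by apply: measurableT_comp => //; exact: (@measurable_zip_with 0).
  rewrite !integral_iid0//.
    by congr F; apply: eq_from_tnth => -[].
  - exact: (measurable_section1 [tuple] mF2).
  - exact: (measurable_fun_fubini_tonelli_F (m2 := iid_law Q 0) _ mF2).
have mF2 : measurable_fun setT (fun u => F (@zip_with n.+1 u.1 u.2)).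
  by apply: measurableT_comp => //; exact: (@measurable_zip_with n.+1).
have mFc : measurable_fun setT (fun u : T * n.-tuple T => F (tcons u)).
  exact: measurableT_comp.
have mF3 x : measurable_fun setT (fun z : n.-tuple T => F (tcons (x, z))).
  exact: (measurable_section1 x mFc).
rewrite [LHS]integral_iidS// [RHS]integral_iidS//; last 2 first.
- exact: (measurable_fun_fubini_tonelli_F (m2 := iid_law Q n.+1) _ mF2).
- by move=> x; exact: integral_ge0.
have mFF : measurable_fun setT (fun a =>
    \int[iid_law (distribution (P \x Q)%E phi) n]_z F (tcons (a, z))).
  exact: (measurable_fun_fubini_tonelli_F (m2 := iid_law _ n) _ mFc).
rewrite ge0_integral_distribution//; last by move=> x; exact: integral_ge0.
rewrite fubini_tonelli1//; last 2 first.
- exact: measurableT_comp.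
- by move=> u; exact: integral_ge0.
apply: eq_integral => x _; rewrite /fubini_F/=.
under eq_integral => y _ do rewrite IH//.
have mG : measurable_fun setT (fun w : (T2 * n.-tuple T1) * n.-tuple T2 =>
    F (tcons (phi (x, w.1.1), zip_with w.1.2 w.2))).
  apply: (measurableT_comp mFc); apply: measurable_fun_pair.
    apply: measurableT_comp => //; apply: measurable_fun_pair => //.
    exact: (measurableT_comp measurable_fst measurable_fst).
  have mp : measurable_fun setT
      (fun w : (T2 * n.-tuple T1) * n.-tuple T2 => (w.1.2, w.2)).
    apply: measurable_fun_pair => //.
    exact: (measurableT_comp measurable_snd measurable_fst).
  exact: (measurableT_comp (@measurable_zip_with n) mp).
rewrite (fubini_tonelli (m1 := Q) (m2 := iid_law P n)
  (fun w => \int[iid_law Q n]_b F (tcons (phi (x, w.1), zip_with w.2 b)))).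
- apply: eq_integral => z _; rewrite integral_iidS//.
  + by apply: eq_integral => y _; apply: eq_integral => t _; rewrite zip_with_tcons.
  + exact: (measurable_section1 (tcons (x, z)) mF2).
- exact: (measurable_fun_fubini_tonelli_F (m2 := iid_law Q n) _ mG).
- by move=> w; exact: integral_ge0.
Qed.

End paired_sample.

Section densities.
Context d (T : measurableType d) (R : realType).
Local Open Scope ereal_scope.

(** The density f agrees almost everywhere with the Radon-Nikodym derivative of P,
by uniqueness of the latter. *)
Lemma integral_density (P : probability T R)
    (mu : {sigma_finite_measure set T -> \bar R}) (f : T -> R)
    (g : T -> \bar R) :
  measurable_fun setT f -> (forall x, (0 <= f x)%R) ->
  (forall A, measurable A -> P A = \int[mu]_(x in A) (f x)%:E) ->
  measurable_fun setT g -> (forall x, 0 <= g x) ->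
  \int[P]_x g x = \int[mu]_x (g x * (f x)%:E).
Proof.
move=> mf f0 Pf mg g0.
have mfE : measurable_fun setT (EFin \o f) by exact/measurable_EFinP.
have Pmu : P `<< mu.
  apply/null_content_dominatesP => A mA muA0; rewrite Pf//.
  by apply: null_set_integral => //; exact: measurable_funTS.
rewrite -(Radon_Nikodym_SigmaFinite.change_of_variables Pmu)//.
apply: ae_eq_integral => //.
- apply: emeasurable_funM => //; apply: (measurable_int mu).
  exact: Radon_Nikodym_SigmaFinite.f_integrable.
- exact: emeasurable_funM.
- apply: ae_eqe_mul2l; apply: integral_ae_eq => //.
  + exact: Radon_Nikodym_SigmaFinite.f_integrable.
  + move=> A _ mA; rewrite -Pf//; apply/esym.
    exact: Radon_Nikodym_SigmaFinite.f_integral.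
Qed.

End densities.

Section gaussian_shift.
Context (R : realType).
Local Open Scope ereal_scope.

(** Likelihood ratio of N(a, sigma^2) with respect to N(0, sigma^2). *)
Definition gauss_ratio (sigma a y : R) : R :=
  expR (a * y / sigma ^+ 2 - a ^+ 2 / (2 * sigma ^+ 2)).

Lemma normal_pdf_shift (sigma a y : R) : sigma != 0%R ->
  normal_pdf 0 sigma (y - a)%R = (gauss_ratio sigma a y * normal_pdf 0 sigma y)%R.
Proof.
move=> s0; rewrite !normal_pdfE//= /normal_fun /gauss_ratio mulrCA -expRD.
by congr (_ * expR _)%R; field.
Qed.

Lemma integral_normal_shift (sigma a : R) (g : R -> \bar R) : (sigma != 0)%R ->
  measurable_fun [set: measurableTypeR R] g -> (forall y, 0 <= g y) ->
  \int[normal_prob 0 sigma]_y g (a + y)%R =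
  \int[normal_prob 0 sigma]_y (g y * (gauss_ratio sigma a y)%:E).
Proof.
move=> s0 mg g0.
have mpdf := @measurable_normal_pdf R 0 sigma.
have mr : measurable_fun [set: measurableTypeR R] (gauss_ratio sigma a).
  apply: measurableT_comp => //; apply: measurable_funB => //.
  by apply: measurable_funM => //; exact: measurable_funM.
have dens h : measurable_fun [set: measurableTypeR R] h -> (forall y, 0 <= h y) ->
    \int[normal_prob 0 sigma]_y h y =
    \int[lebesgue_measure]_y (h y * (normal_pdf 0 sigma y)%:E).
  move=> mh h0; apply: integral_density => //.
  by move=> x; exact: normal_pdf_ge0.
rewrite dens//; last first.
  apply: (measurableT_comp mg); exact: measurable_funD.
rewrite dens//; last 2 first.
- by apply: emeasurable_funM => //; exact/measurable_EFinP.
- by move=> y; rewrite mule_ge0// lee_fin expR_ge0.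
rewrite [RHS](ge0_integral_affine a (@ltr01 R)); last 2 first.
- apply: emeasurable_funM; last exact/measurable_EFinP.
  by apply: emeasurable_funM => //; exact/measurable_EFinP.
- by move=> y; rewrite !mule_ge0// lee_fin ?expR_ge0// normal_pdf_ge0.
rewrite mul1e; apply: eq_integral => y _; rewrite mul1r addrC.
by rewrite -muleA -EFinM -normal_pdf_shift// addrK.
Qed.

(** Completing the square, the integrand is a constant times the likelihood ratio
for the shift t * sigma^2, which integrates to 1. *)
Lemma integral_normal_expR (sigma t : R) : (sigma != 0)%R ->
  \int[normal_prob 0 sigma]_y (expR (t * y))%:E =
  (expR (t ^+ 2 * sigma ^+ 2 / 2))%:E.
Proof.
move=> s0.
have H : \int[normal_prob 0 sigma]_y (gauss_ratio sigma (t * sigma ^+ 2) y)%:E = 1.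
  transitivity (\int[normal_prob 0 sigma]_y
    (1 * (gauss_ratio sigma (t * sigma ^+ 2) y)%:E)).
    by apply: eq_integral => y _; rewrite mul1e.
  rewrite -(integral_normal_shift _ (g := cst 1))//.
  by rewrite integral_cst// mul1e; exact: probability_setT.
set c := expR (t ^+ 2 * sigma ^+ 2 / 2).
transitivity (\int[normal_prob 0 sigma]_y
  (c%:E * (gauss_ratio sigma (t * sigma ^+ 2) y)%:E)).
  apply: eq_integral => y _; rewrite -EFinM /c /gauss_ratio -expRD.
  by congr (expR _)%:E; field.
rewrite ge0_integralZl//; last 3 first.
- apply/measurable_EFinP; apply: measurableT_comp => //.
  apply: measurable_funB => //.
  by apply: measurable_funM => //; exact: measurable_funM.
- by move=> y _; rewrite lee_fin expR_ge0.
- by rewrite lee_fin expR_ge0.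
by rewrite H mule1.
Qed.

End gaussian_shift.

(** * Lower bound: two hypotheses *)

Section likelihood.
Context (R : realType) (mu : design_density R) (sigma : R).
Hypothesis sigma0 : 0 < sigma.
Local Open Scope ereal_scope.

Let sn0 : (sigma != 0)%R. Proof. by rewrite gt_eqF. Qed.

Lemma integral_observation (f : {mfun R >-> R}) (g : R * R -> \bar R) :
  measurable_fun setT g -> (forall z, 0 <= g z) ->
  \int[observation_law f mu sigma]_z g z =
  \int[design_law mu]_x \int[normal_prob 0 sigma]_y g (x, (f x + y)%R).
Proof.
move=> mg g0; rewrite ge0_integral_distribution// fubini_tonelli1//.
  by apply: measurableT_comp => //; exact: measurable_funPT.
by move=> u; exact: g0.
Qed.

Definition obs_ratio (f : R -> R) (z : R * R) : R :=
  gauss_ratio sigma (f z.1) z.2.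

Lemma measurable_obs_ratio (f : {mfun R >-> R}) :
  measurable_fun setT (obs_ratio f).
Proof.
have mf : measurable_fun setT (fun z : R * R => f z.1).
  by apply: (@measurableT_comp _ _ _ _ _ _ f).
rewrite /obs_ratio /gauss_ratio; apply: measurableT_comp => //.
apply: measurable_funB; apply: measurable_funM => //.
  exact: measurable_funM.
exact: measurable_funX.
Qed.

Lemma integral_observation_ratio (f : {mfun R >-> R}) (g : R * R -> \bar R) :
  measurable_fun setT g -> (forall z, 0 <= g z) ->
  \int[observation_law f mu sigma]_z g z =
  \int[observation_law (cst 0%R) mu sigma]_z (g z * (obs_ratio f z)%:E).
Proof.
move=> mg g0; have mr := measurable_obs_ratio f.
have mgr : measurable_fun setT (fun z => g z * (obs_ratio f z)%:E).
  by apply: emeasurable_funM => //; exact/measurable_EFinP.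
have gr0 z : 0 <= g z * (obs_ratio f z)%:E.
  by rewrite mule_ge0// lee_fin expR_ge0.
apply: etrans (integral_observation f mg g0) _.
apply/esym; apply: etrans (integral_observation _ mgr gr0) _; apply/esym.
apply: eq_integral => x _.
transitivity (\int[normal_prob 0 sigma]_y
    (g (x, y) * (gauss_ratio sigma (f x) y)%:E)).
  have mgx : measurable_fun [set: measurableTypeR R] (fun y => g (x, y)).
    exact: measurable_section1 x mg.
  exact: (integral_normal_shift (f x) sn0 mgx (fun y => g0 (x, y))).
by apply: eq_integral => y _; rewrite /obs_ratio /= add0r.
Qed.

Lemma integral_obs_ratio_sqr (f : {mfun R >-> R}) :
  \int[observation_law (cst 0%R) mu sigma]_z (obs_ratio f z ^+ 2)%:E =
  \int[design_law mu]_x (expR (f x ^+ 2 / sigma ^+ 2))%:E.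
Proof.
have mr := measurable_obs_ratio f.
rewrite integral_observation; last 2 first.
- by apply/measurable_EFinP; exact: measurable_funX.
- by move=> z; rewrite lee_fin sqr_ge0.
apply: eq_integral => x _.
set a := f x; set t := (2 * a / sigma ^+ 2)%R.
transitivity (\int[normal_prob 0 sigma]_y
    ((expR (- (a ^+ 2 / sigma ^+ 2)))%:E * (expR (t * y))%:E)).
  apply: eq_integral => y _; rewrite /obs_ratio /gauss_ratio/= add0r -EFinM.
  by rewrite -expRM_natl -expRD -/a /t; congr (expR _)%:E; field.
rewrite ge0_integralZl//; last first.
  by apply/measurable_EFinP; apply: measurableT_comp.
rewrite integral_normal_expR// -EFinM -expRD /t; congr (expR _)%:E.
by field.
Qed.

End likelihood.

Section two_points.
Context (R : realType).

Definition bump (x0 h theta : R) (x : R) : R :=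
  theta * \1_(`[x0 - h, x0 + h]%classic) x.

Let measurable_bump x0 h theta : measurable_fun setT (bump x0 h theta).
Proof. by apply: measurable_funM => //; exact: measurable_indic. Qed.

HB.instance Definition _ x0 h theta :=
  isMeasurableFun.Build _ _ _ _ (bump x0 h theta) (measurable_bump x0 h theta).

Lemma bump_in (x0 h theta x : R) : `|x - x0| <= h -> bump x0 h theta x = theta.
Proof.
rewrite ler_distl /bump indicE => xh.
by rewrite mem_set ?mulr1//= in_itv.
Qed.

(** A constant polynomial has no error on a window where f is constant. *)
Lemma local_constant (delta x0 s theta : R) (omega f : R -> R) :
  (forall h, 0 < h -> 0 < omega h) ->
  (forall x, `|x - x0| <= delta -> f x = theta) ->
  local_class delta x0 s omega f.
Proof.
move=> om0 ftheta h /andP[h0 hd].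
apply: (@le_trans _ _ 0%E); last by rewrite lee_fin ltW// om0.
apply: (@le_trans _ _ (ereal_sup [set (`|f x - (theta%:P).[x - x0]|)%:E
  | x in [set x | x \in `[0%R, 1%R] /\ `|x - x0| <= h]])); last first.
  apply: ge_ereal_sup => _ [x [_ xh] <-].
  by rewrite hornerC ftheta ?subrr ?normr0// (le_trans xh).
apply: ereal_inf_lbound; exists theta%:P => //=.
by rewrite (leq_trans (size_polyC_leq1 _)).
Qed.

Lemma bump_Sigma (h alpha x0 s theta : R) (omega : R -> R) :
  (forall t, 0 < t -> 0 < omega t) -> 0 <= theta -> theta <= alpha ->
  Sigma_class h alpha x0 s omega (bump x0 h theta).
Proof.
move=> om0 t0 ta; split; first by apply: local_constant om0 _; exact: bump_in.
move=> x _; rewrite /bump normrM ger0_norm// (le_trans _ ta)//.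
by rewrite ler_piMr// indicE; case: (_ \in _); rewrite ?normr1 ?normr0.
Qed.

Lemma zero_Sigma (h alpha x0 s : R) (omega : R -> R) :
  (forall t, 0 < t -> 0 < omega t) -> 0 <= alpha ->
  Sigma_class h alpha x0 s omega (cst 0).
Proof.
move=> om0 a0; split; first exact: (local_constant s om0 (theta := 0)).
by move=> x _; rewrite normr0.
Qed.

(** T is at distance at least theta / 2 from 0 or from theta. In the first case
conclude by L <= 1 + L^2 / 4. *)
Lemma two_point_le (p theta T L : R) : 0 < p -> 0 < theta -> 0 <= L ->
  (theta / 2) `^ p * L <=
  `|T - 0| `^ p + `|T - theta| `^ p * L + (theta / 2) `^ p / 4 * L ^+ 2.
Proof.
move=> p0 t0 L0; set c := (theta / 2) `^ p.
have c0 : 0 <= c by exact: powR_ge0.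
have t20 : theta / 2 \is Num.nneg by rewrite nnegrE divr_ge0// ltW.
rewrite subr0; have [tT|tT] := leP (theta / 2) `|T|.
  have cT : c <= `|T| `^ p.
    by apply: ge0_ler_powR; rewrite ?(ltW p0)// nnegrE.
  have : 0 <= `|T - theta| `^ p * L by rewrite mulr_ge0// powR_ge0.
  have : 0 <= c * (1 - L / 2) ^+ 2 by rewrite mulr_ge0// sqr_ge0.
  by lra.
have cT : c <= `|T - theta| `^ p.
  apply: ge0_ler_powR; rewrite ?(ltW p0)// ?nnegrE//.
  rewrite distrC; apply: le_trans (ler_norm _).
  by have := ler_norm T; lra.
have : c * L <= `|T - theta| `^ p * L by exact: ler_wpM2r.
have : 0 <= `|T| `^ p by exact: powR_ge0.
have : 0 <= c / 4 * L ^+ 2 by rewrite mulr_ge0 ?sqr_ge0// divr_ge0.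
by lra.
Qed.

(** Integrate [two_point_le] under the null hypothesis, where L is the likelihood
ratio: it has mean 1 and a second moment at most expR (1/2) <= 2. So the sum of
the two risks is at least half of (theta / 2) `^ p. *)
Lemma minimax_two_point (p sigma x0 h theta : R) (mu : design_density R) n
    (Sigma : set (R -> R)) :
  0 < p -> 0 < sigma -> 0 < theta -> 0 < h ->
  Sigma (cst 0) -> Sigma (bump x0 h theta) ->
  (\int[design_law mu]_x (expR (bump x0 h theta x ^+ 2 / sigma ^+ 2))%:E
    <= (expR (2 * n%:R)^-1)%:E)%E ->
  (((theta / 2) * (4^-1) `^ (p^-1))%:E <= minimax_risk p sigma x0 Sigma mu n)%E.
Proof.
move=> p0 sigma0 theta0 h0 S0 S1 chi2.
pose c := (theta / 2) `^ p; pose k := c / 4.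
have t2 : 0 < theta / 2 by rewrite divr_gt0.
have c0 : 0 <= c by exact: powR_ge0.
have k0 : 0 <= k by rewrite divr_ge0.
suff kinf : (k%:E <= ereal_inf [set
     ereal_sup [set
       \int[sample_law f mu sigma n]_z ((`|T z - f x0| `^ p)%R)%:E
     | f in [set f : {mfun R >-> R} | Sigma f]]
   | T in [set: {mfun (n.-tuple (R * R)) >-> R}]])%E.
  rewrite /minimax_risk; apply: (@le_trans _ _ (k%:E `^ p^-1)%E).
    rewrite poweR_EFin lee_fin /k powRM ?invr_ge0// /c -powRrM mulfV ?gt_eqF//.
    by rewrite powRr1// ltW.
  apply: gt0_ler_poweR => //; first by rewrite invr_ge0 ltW.
    by rewrite in_itv/= lee_fin k0 leey.
  by rewrite in_itv/= (le_trans _ kinf) ?lee_fin// leey.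
apply: le_ereal_inf_tmp => _ [T _ <-].
set S := ereal_sup _.
pose f0 : {mfun R >-> R} := cst 0.
pose P0 := sample_law f0 mu sigma n.
pose ell := obs_ratio sigma (bump x0 h theta).
have mell : measurable_fun setT ell := measurable_obs_ratio _ _.
have ell0 z : 0 <= ell z by exact: expR_ge0.
pose L (z : n.-tuple (R * R)) := \prod_(i < n) ell (tnth z i).
have mL : measurable_fun setT L by exact: (@measurable_prod_tnth _ _ _ _ (fun=> ell)).
have L0 z : 0 <= L z by exact: prodr_ge0.
have dens F : measurable_fun setT F -> (forall z, (0 <= F z)%E) ->
    (\int[sample_law (bump x0 h theta) mu sigma n]_z F z =
     \int[P0]_z (F z * (L z)%:E))%E.
  move=> mF F0; pose P1 := observation_law (bump x0 h theta) mu sigma.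
  have P10 := fun g => @integral_observation_ratio R mu sigma sigma0 (bump x0 h theta) g.
  exact: (@integral_iid_density _ _ _ (observation_law f0 mu sigma) P1 ell n F
    mell ell0 P10 mF F0).
have mT a : measurable_fun setT (fun z => `|T z - a| `^ p).
  apply: (@measurableT_comp _ _ _ _ _ _ (@powR R ^~ p)) => //.
  apply: measurableT_comp => //; apply: measurable_funB => //.
pose A0 := (\int[P0]_z (`|T z - 0| `^ p)%:E)%E.
pose A1 := (\int[sample_law (bump x0 h theta) mu sigma n]_z (`|T z - theta| `^ p)%:E)%E.
have A0S : (A0 <= S)%E by apply: ereal_sup_ubound; exists f0; [exact: S0|].
have A1S : (A1 <= S)%E.
  apply: ereal_sup_ubound; exists (bump x0 h theta); first exact: S1.
  by apply: eq_integral => z _; rewrite /= bump_in// subrr normr0 ltW.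
have A1E : (A1 = \int[P0]_z (`|T z - theta| `^ p * L z)%:E)%E.
  rewrite /A1 dens; first by apply: eq_integral => z _; rewrite EFinM.
    by apply/measurable_EFinP; exact: mT.
  by move=> z; rewrite lee_fin powR_ge0.
have L1 : (\int[P0]_z (L z)%:E = 1)%E.
  transitivity (\int[P0]_z (1 * (L z)%:E))%E.
    by apply: eq_integral => z _; rewrite mul1e.
  by rewrite -(dens (cst 1%E))// integral_cst// mul1e; exact: probability_setT.
(* the second moment of L is the n-th power of that of one observation *)
have L2 : (\int[P0]_z ((L z) ^+ 2)%:E <= 2%:E)%E.
  set I := (X in (X <= _)%E) in chi2.
  have I0 : (0 <= I)%E by apply: integral_ge0 => x _; rewrite lee_fin expR_ge0.
  have Ifin : I \is a fin_num by rewrite ge0_fin_numE// (le_lt_trans chi2)// ltry.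
  have IL : (\int[P0]_z ((L z) ^+ 2)%:E = ((fine I) ^+ n)%:E)%E.
    have := @integral_iid_prod _ _ _ (observation_law f0 mu sigma) n
      (fun=> fun z => ell z ^+ 2) (fun=> fine I).
    rewrite prodr_const card_ord => <- //.
    - by apply: eq_integral => z _; rewrite /L prodrXl.
    - by move=> _; exact: measurable_funX.
    - by move=> _ z; exact: sqr_ge0.
    - move=> _; rewrite fineK// /I; exact: integral_obs_ratio_sqr.
  rewrite IL lee_fin (@le_trans _ _ (expR (2^-1)))//.
    have Iex : fine I <= expR (2 * n%:R)^-1 by rewrite -lee_fin fineK.
    have [->|n0] := eqVneq n 0%N.
      by rewrite expr0 -[leLHS]expR0 ler_expR.
    apply: (@le_trans _ _ ((expR (2 * n%:R)^-1) ^+ n)).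
      by apply: lerXn2r => //; rewrite nnegrE ?expR_ge0// fine_ge0.
    by rewrite -expRM_natl ler_expR invfM mulrCA mulfV ?mulr1// pnatr_eq0.
  have := expR_ge1Dx (- 2^-1 : R).
  by rewrite expRN -[X in _ <= X]div1r ler_pdivlMr ?expR_gt0//; lra.
have mX0 : measurable_fun setT (fun z => (`|T z - 0| `^ p)%:E).
  by apply/measurable_EFinP; exact: mT.
have mX1 : measurable_fun setT (fun z => (`|T z - theta| `^ p * L z)%:E).
  by apply/measurable_EFinP; apply: measurable_funM => //; exact: mT.
have mX2 : measurable_fun setT (fun z => (L z ^+ 2)%:E).
  by apply/measurable_EFinP; exact: measurable_funX.
have X00 z : (0 <= (`|T z - 0| `^ p)%:E)%E by rewrite lee_fin powR_ge0.
have X10 z : (0 <= (`|T z - theta| `^ p * L z)%:E)%E.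
  by rewrite lee_fin mulr_ge0// powR_ge0.
have X20 z : (0 <= (L z ^+ 2)%:E)%E by rewrite lee_fin sqr_ge0.
have mX2k : measurable_fun setT (fun z => k%:E * (L z ^+ 2)%:E)%E.
  by apply: emeasurable_funM.
have X20k z : (0 <= k%:E * (L z ^+ 2)%:E)%E by rewrite mule_ge0// lee_fin.
have mLE : measurable_fun setT (fun z => (L z)%:E) by exact/measurable_EFinP.
have L0E z : (0 <= (L z)%:E)%E by rewrite lee_fin.
have mcL : measurable_fun setT (fun z => c%:E * (L z)%:E)%E.
  by apply: emeasurable_funM.
have key : ((c%:E) <= A0 + A1 + k%:E * \int[P0]_z ((L z) ^+ 2)%:E)%E.
  rewrite A1E -(ge0_integralZl P0 measurableT mX2 (fun z _ => X20 z) (k := k%:E)) ?lee_fin//.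
  rewrite -(ge0_integralD P0 measurableT (fun z _ => X00 z) mX0 (fun z _ => X10 z) mX1).
  rewrite -(ge0_integralD P0 measurableT
    (fun z _ => adde_ge0 (X00 z) (X10 z)) (emeasurable_funD mX0 mX1)
    (fun z _ => X20k z) mX2k).
  rewrite -[c%:E]mule1 -L1.
  rewrite -(ge0_integralZl P0 measurableT mLE (fun z _ => L0E z) (k := c%:E))
    ?lee_fin//.
  apply: ge0_le_integral => //.
  - by move=> z _; rewrite lee_fin mulr_ge0.
  - by apply: emeasurable_funD => //; exact: emeasurable_funD.
  - by move=> z _; rewrite -!EFinM -!EFinD lee_fin two_point_le.
have key2 : (c%:E <= S + S + (k * 2)%:E)%E.
  apply: (le_trans key); apply: leeD; first exact: leeD.
  by rewrite [(k * 2)%:E]EFinM; apply: lee_wpmul2l => //; rewrite lee_fin.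
move: key2; generalize S => -[r| |] key2 //.
  by move: key2; rewrite -!EFinD !lee_fin /k; lra.
by rewrite leey.
Qed.

End two_points.

(** * Averaged Lagrange extrapolation *)

Section lagrange_extrapolation.
Context (R : realFieldType) (k : nat).
Implicit Types (x : 'I_k.+1 -> R) (P : {poly R}).

(** Value at 0 of the j-th Lagrange basis polynomial of the nodes x. *)
Definition lag x (j : 'I_k.+1) : R :=
  \prod_(l < k.+1 | l != j) ((0 - x l) / (x j - x l)).

Let lagpoly x (j : 'I_k.+1) : {poly R} :=
  \prod_(l < k.+1 | l != j) ((x j - x l)^-1 *: ('X - (x l)%:P)).

Let size_lagpoly x j : (size (lagpoly x j) <= k.+1)%N.
Proof.
apply: leq_trans (size_poly_prod_leq _ _) _ => /=.
rewrite -sum1_card; have -> : (\sum_(i < k.+1 | i != j) 1 = k)%N.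
  by rewrite sum1_card cardC1 card_ord.
rewrite leq_subLR -addSnnS addSn ltnS.
apply: (@leq_trans (\sum_(i < k.+1 | i != j) 2)%N).
  apply: leq_sum => i _; apply: leq_trans (size_scale_leq _ _) _.
  by rewrite size_XsubC.
by rewrite sum_nat_const cardC1 card_ord muln2 addnn.
Qed.

Let lagpolyE x j l : injective x -> (lagpoly x j).[x l] = (l == j)%:R.
Proof.
move=> xi; rewrite horner_prod; have [->|lj] := eqVneq l j.
  rewrite big1// => i ij; rewrite hornerZ hornerXsubC mulVf// subr_eq0.
  by apply: contra ij => /eqP/xi->.
rewrite (bigD1 l)//= hornerZ hornerXsubC subrr mulr0 mul0r.
by [].
Qed.

Lemma lagrange_at0 x P : injective x -> (size P <= k.+1)%N ->
  P.[0] = \sum_j P.[x j] * lag x j.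
Proof.
move=> xi sP; pose Q := \sum_j P.[x j] *: lagpoly x j.
have sQ : (size Q <= k.+1)%N.
  apply: leq_trans (size_sum _ _ _) _; apply/bigmax_leqP => j _.
  exact: leq_trans (size_scale_leq _ _) _.
have PQ : P = Q.
  apply/eqP; rewrite -subr_eq0; apply/negP => /negP d0.
  have sPQ : (size (P - Q)%R <= k.+1)%N.
    by rewrite (leq_trans (size_polyD _ _))// geq_max size_polyN sP.
  have : (size (codom x) < size (P - Q)%R)%N.
    apply: (max_poly_roots (rs := codom x) d0); last first.
      by rewrite map_inj_uniq// enum_uniq.
    apply/allP => _ /codomP[l ->]; rewrite /root hornerD hornerN horner_sum.
    rewrite (bigD1 l)//= hornerZ lagpolyE// eqxx mulr1 big1 ?addr0 ?subrr// => j jl.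
    by rewrite hornerZ lagpolyE// eq_sym (negbTE jl) mulr0.
  by rewrite size_codom card_ord => /leq_trans/(_ sPQ); rewrite ltnn.
rewrite [in LHS]PQ horner_sum; apply: eq_bigr => j _.
rewrite hornerZ horner_prod; congr (_ * _); apply: eq_bigr => l _.
by rewrite hornerZ hornerXsubC mulrC.
Qed.

Lemma lag_le x j (h eta : R) : 0 < eta -> 0 < h -> (forall l, `|x l| <= h) ->
  (forall l l', l != l' -> eta * h <= `|x l - x l'|) ->
  `|lag x j| <= (eta^-1) ^+ k.
Proof.
move=> eta0 h0 xh sep; rewrite normr_prod.
apply: le_trans (_ : \prod_(l < k.+1 | l != j) eta^-1 <= _); last first.
  by rewrite prodr_const cardC1 card_ord.
apply: ler_prod => l lj; rewrite normr_ge0/= normrM normfV sub0r normrN.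
have d0 : 0 < `|x j - x l|.
  by apply: lt_le_trans (sep j l _); rewrite ?mulr_gt0// eq_sym.
rewrite ler_pdivrMr//; apply: le_trans (xh l) _.
by rewrite ler_pdivlMl// sep// eq_sym.
Qed.

End lagrange_extrapolation.

Section tuple_average.
Context (R : realFieldType) (k n : nat).
Variables (b : 'I_k.+1 -> pred R) (x : 'I_n -> R).
Implicit Types (phi : {ffun 'I_k.+1 -> 'I_n}) (g : 'I_n -> R) (P : {poly R}).

Definition block_count (j : 'I_k.+1) : R := \sum_(i < n) (b j (x i))%:R.

Definition in_blocks phi : R := \prod_(j < k.+1) (b j (x (phi j)))%:R.

(** Coefficient of the i-th response in the average of the extrapolations at 0,
over all choices phi of one point in each block. *)
Definition weight (i : 'I_n) : R :=
  (\sum_phi in_blocks phi)^-1 *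
  \sum_phi in_blocks phi * \sum_(j < k.+1) lag (x \o phi) j * (phi j == i)%:R.

Lemma in_blocks_ge0 phi : 0 <= in_blocks phi.
Proof. by apply: prodr_ge0 => j _; exact: ler0n. Qed.

Lemma in_blocks_neq0 phi j : in_blocks phi != 0 -> b j (x (phi j)).
Proof.
rewrite /in_blocks => /prodf_neq0/(_ j isT); rewrite pnatr_eq0 eqb0.
by rewrite negbK.
Qed.

Lemma sum_in_blocks : \sum_phi in_blocks phi = \prod_j block_count j.
Proof. by rewrite /block_count bigA_distr_bigA. Qed.

Lemma sum_weight g : \sum_i weight i * g i =
  (\sum_phi in_blocks phi)^-1 *
  \sum_phi in_blocks phi * \sum_(j < k.+1) lag (x \o phi) j * g (phi j).
Proof.
under eq_bigr do rewrite -mulrA; rewrite -mulr_sumr; congr (_ * _).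
under eq_bigr do rewrite mulr_suml; rewrite exchange_big; apply: eq_bigr => phi _.
under eq_bigr do rewrite -mulrA; rewrite -mulr_sumr; congr (_ * _).
under eq_bigr do rewrite mulr_suml; rewrite exchange_big; apply: eq_bigr => j _.
under eq_bigr do rewrite -mulrA; rewrite -mulr_sumr; congr (_ * _).
rewrite (bigD1 (phi j))//= eqxx mul1r big1 ?addr0// => i ij.
by rewrite eq_sym (negbTE ij) mul0r.
Qed.

Variables (m B : R).
Hypotheses (m0 : 0 < m) (B0 : 0 <= B).
Hypothesis full : forall j, m <= block_count j.
Hypothesis lagB : forall phi j, in_blocks phi != 0 -> `|lag (x \o phi) j| <= B.

Let D := \sum_phi in_blocks phi.

Let D0 : 0 < D.
Proof.
rewrite /D sum_in_blocks; apply: prodr_gt0 => j _.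
exact: lt_le_trans (full j).
Qed.

(** Every extrapolation is exact on P, hence so is their average. *)
Lemma weight_poly P : (size P <= k.+1)%N ->
  (forall phi, in_blocks phi != 0 -> injective (x \o phi)) ->
  \sum_i weight i * P.[x i] = P.[0].
Proof.
move=> sP inj; rewrite sum_weight -/D.
have -> : \sum_phi in_blocks phi * \sum_j lag (x \o phi) j * P.[x (phi j)] =
    \sum_phi in_blocks phi * P.[0].
  apply: eq_bigr => phi _.
  have [->|nz] := eqVneq (in_blocks phi) 0; first by rewrite !mul0r.
  rewrite (lagrange_at0 (inj _ nz) sP); congr (_ * _).
  by apply: eq_bigr => j _; rewrite mulrC.
by rewrite -mulr_suml mulrA mulVf ?mul1r// gt_eqF.
Qed.

Lemma sum_weight_le g M : 0 <= M -> (forall i j, b j (x i) -> `|g i| <= M) ->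
  \sum_i `|weight i| * `|g i| <= k.+1%:R * B * M.
Proof.
move=> M0 gM.
pose s i : R := Num.sg (weight i) * `|g i|.
have -> : \sum_i `|weight i| * `|g i| = \sum_i weight i * s i.
  by apply: eq_bigr => i _; rewrite /s mulrA [weight i * _]mulrC -normrEsg.
rewrite sum_weight -/D ler_pdivrMl//.
rewrite mulr_suml; apply: ler_sum => phi _.
have [->|nz] := eqVneq (in_blocks phi) 0; first by rewrite !mul0r.
rewrite ler_wpM2l ?in_blocks_ge0// -mulrA mulr_natl -[leRHS]/(B * M *+ k.+1).
rewrite -[X in _ *+ X](card_ord k.+1) -sumr_const; apply: ler_sum => j _.
apply: le_trans (ler_norm _) _; rewrite normrM ler_pM// ?lagB//.
rewrite /s normrM normr_id; apply: le_trans (gM _ j (in_blocks_neq0 j nz)).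
by rewrite ler_piMl// normr_sg; case: eqP.
Qed.

(** Among the choices of one point per block, those that use the i-th point in
block j form a fraction 1 / N_j of all, where N_j counts the points of that
block. *)
Lemma weight_le i : `|weight i| <= k.+1%:R * B / m.
Proof.
rewrite /weight -/D normrM gtr0_norm ?invr_gt0// ler_pdivrMl//.
apply: le_trans (ler_norm_sum _ _ _) _.
apply: (@le_trans _ _ (\sum_phi \sum_(j < k.+1) B * (in_blocks phi * (phi j == i)%:R))).
  apply: ler_sum => phi _; rewrite normrM ger0_norm ?in_blocks_ge0//.
  have [->|nz] := eqVneq (in_blocks phi) 0.
    by rewrite mul0r big1// => j _; rewrite mul0r mulr0.
  under [leRHS]eq_bigr do rewrite mulrCA.
  rewrite -mulr_sumr ler_wpM2l ?in_blocks_ge0//.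
  apply: le_trans (ler_norm_sum _ _ _) _; apply: ler_sum => j _.
  by rewrite normrM normr_nat ler_wpM2r// lagB.
rewrite exchange_big/=.
have -> : D * (k.+1%:R * B / m) = B * (D / m) *+ k.+1 by rewrite -mulr_natl; ring.
rewrite -[X in _ *+ X](card_ord k.+1) -sumr_const; apply: ler_sum => j _.
rewrite -mulr_sumr ler_wpM2l// ler_pdivlMr//.
(* fixing the j-th index to be i removes the factor of block j from the sum *)
have -> : \sum_phi in_blocks phi * (phi j == i)%:R =
    (b j (x i))%:R * \prod_(l < k.+1 | l != j) block_count l.
  pose F l i' : R := (b l (x i'))%:R * ((l == j) ==> (i' == i))%:R.
  transitivity (\prod_l \sum_i' F l i').
    rewrite bigA_distr_bigA; apply: eq_bigr => phi _.
    rewrite /F big_split/=; congr (_ * _).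
    rewrite (bigD1 j)//= eqxx implyTb big1 ?mulr1// => l lj.
    by rewrite (negbTE lj).
  rewrite (bigD1 j)//=; congr (_ * _).
    rewrite (bigD1 i)//= /F !eqxx mulr1 big1 ?addr0// => i' ii.
    by rewrite (negbTE ii) mulr0.
  apply: eq_bigr => l lj; apply: eq_bigr => i' _.
  by rewrite /F (negbTE lj) mulr1.
have p0 : 0 <= \prod_(l < k.+1 | l != j) block_count l.
  by apply: prodr_ge0 => l _; exact: le_trans (ltW m0) (full l).
rewrite /D sum_in_blocks [in leRHS](bigD1 j)//= mulrAC ler_wpM2r//.
apply: le_trans (full j); rewrite ler_piMl ?(ltW m0)//.
by case: (b j (x i)).
Qed.

Lemma sum_weight_sqr : \sum_i weight i ^+ 2 <= (k.+1%:R * B) ^+ 2 / m.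
Proof.
apply: (@le_trans _ _ (\sum_i k.+1%:R * B / m * (`|weight i| * `|1|))).
  apply: ler_sum => i _; rewrite normr1 mulr1 -[leLHS]ger0_norm ?sqr_ge0// expr2 normrM.
  by rewrite ler_wpM2r// weight_le.
rewrite -mulr_sumr expr2 [leRHS]mulrAC ler_wpM2l ?divr_ge0 ?mulr_ge0 ?(ltW m0)//.
rewrite -[leRHS]mulr1; apply: (sum_weight_le (g := fun=> 1)) => // i j _.
by rewrite normr1.
Qed.

End tuple_average.

(** * The estimator *)

Section elementary_bounds.
Context (R : realType).

Definition pow_cst (p : R) : R := ((Num.bound p).+1)`!%:R.

Lemma powR_le_expR (p u : R) : 0 < p -> 0 <= u ->
  u `^ p <= pow_cst p * expR u.
Proof.
move=> p0 u0; have K1 : 1 <= pow_cst p by rewrite ler1n fact_gt0.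
have [u1|u1] := leP u 1.
  apply: (@le_trans _ _ 1).
    have o : (1 : R) `^ p = 1 by rewrite powR1.
    by rewrite -[leRHS]o; apply: ge0_ler_powR; rewrite ?nnegrE ?(ltW p0).
  by rewrite -[leLHS]mulr1 ler_pM ?ler01// -expR0 ler_expR.
set N := (Num.bound p).
have pN : p <= N.+1%:R.
  by apply/ltW/(lt_trans (archi_boundP (ltW p0))); rewrite ltr_nat.
apply: (@le_trans _ _ (u `^ N.+1%:R)); first exact: ler_powR (ltW u1) _ _ pN.
rewrite powR_mulrn//; have := expR_ge1Dxn N u0 => h.
rewrite /pow_cst -/N -ler_pdivrMl ?ltr0n ?fact_gt0// mulrC.
by apply: le_trans h; rewrite lerDr.
Qed.

Lemma expR_N1_le : expR (- 1 : R) <= 2^-1.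
Proof.
by rewrite expRN lef_pV2 ?posrE ?expR_gt0//; have := expR_ge1Dx (1 : R); lra.
Qed.

Lemma measurable_invr : measurable_fun [set: R] (@GRing.inv R).
Proof.
have -> : @GRing.inv R = fun x : R => x * (x ^+ 2) `^ (-1).
  apply/funext => x; rewrite powR_inv1 ?sqr_ge0//.
  by have [->|x0] := eqVneq x 0; rewrite ?invr0 ?mul0r//; field.
apply: measurable_funM => //.
by apply: (@measurableT_comp _ _ _ _ _ _ (@powR R ^~ (-1))).
Qed.

End elementary_bounds.

Section blocks.
Context (R : realType) (k : nat).

(** Blocks of the right half window, separated by gaps of their own width so that
the nodes of an extrapolation stay apart. *)
Definition block (h : R) (j : 'I_k.+1) : pred R := fun t =>
  (j.*2%:R * (h / k.*2.+1%:R) < t) && (t <= j.*2.+1%:R * (h / k.*2.+1%:R)).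

Definition lag_cst : R := k.*2.+1%:R ^+ k.

Lemma block_bound h j t : 0 < h -> block h j t -> 0 < t <= h.
Proof.
move=> h0 /andP[lt1 lt2]; apply/andP; split.
  by apply: le_lt_trans lt1; rewrite mulr_ge0// divr_ge0// ltW.
apply: le_trans lt2 _; rewrite mulrCA ler_piMr ?(ltW h0)// ler_pdivrMr// mul1r.
by rewrite ler_nat ltnS leq_double -ltnS.
Qed.

Lemma block_sep h j l t u : 0 < h -> j != l -> block h j t -> block h l u ->
  (k.*2.+1%:R)^-1 * h <= `|t - u|.
Proof.
move=> h0; wlog jl : j l t u / (j < l)%N.
  move=> H jl bt bu; have [lt|gt|e] := ltngtP j l.
  - exact: (H j l t u).
  - by rewrite distrC; apply: (H l j u t) => //; rewrite eq_sym.
  - by move: jl; rewrite (val_inj e) eqxx.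
move=> _ /andP[_ t1] /andP[u1 _]; rewrite distrC.
apply: le_trans (ler_norm _); rewrite mulrC.
set e := h / _ in t1 u1 *; have e0 : 0 <= e by rewrite divr_ge0// ltW.
have : j.*2.+1%:R * e + e <= l.*2%:R * e.
  rewrite -[X in _ + X]mul1r -mulrDl ler_wpM2r// natr1 ler_nat.
  by rewrite -doubleS leq_double.
by lra.
Qed.

Variables (n : nat) (x : 'I_n -> R) (h : R).
Hypothesis h0 : 0 < h.

Let sep (phi : {ffun 'I_k.+1 -> 'I_n}) l l' :
  in_blocks (block h) x phi != 0 -> l != l' ->
  (k.*2.+1%:R)^-1 * h <= `|x (phi l) - x (phi l')|.
Proof.
move=> nz ll'; have bl i := in_blocks_neq0 i nz.
exact: block_sep ll' (bl l) (bl l').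
Qed.

Lemma block_injective (phi : {ffun 'I_k.+1 -> 'I_n}) :
  in_blocks (block h) x phi != 0 -> injective (x \o phi).
Proof.
move=> nz l l' /= e; apply/eqP; apply: contraT => ll'.
by have := sep nz ll'; rewrite e subrr normr0 leNgt mulr_gt0.
Qed.

Lemma block_lag (phi : {ffun 'I_k.+1 -> 'I_n}) j :
  in_blocks (block h) x phi != 0 -> `|lag (x \o phi) j| <= lag_cst.
Proof.
move=> nz; rewrite /lag_cst -[X in X ^+ _]invrK.
apply: (@lag_le _ _ _ _ h) => //.
  move=> l /=; have /andP[t0 th] := block_bound h0 (in_blocks_neq0 l nz).
  by rewrite gtr0_norm.
by move=> l l'; exact: sep.
Qed.

End blocks.

Section estimator.
Context (R : realType) (k n : nat) (x0 h m : R).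

Definition full_blocks (x : 'I_n -> R) : R :=
  \prod_(j < k.+1) (m <= block_count (@block R k h) x j)%R%:R.

Definition offsets (z : n.-tuple (R * R)) (i : 'I_n) : R := (tnth z i).1 - x0.

(** The factor [full_blocks] replaces the estimator by 0 when a block is too
empty for the weights to be small; the error is then at most the bound on f. *)
Definition est (z : n.-tuple (R * R)) : R :=
  full_blocks (offsets z) *
  \sum_(i < n) weight (@block R k h) (offsets z) i * (tnth z i).2.

Section measurability.
Context d (T : measurableType d) (x : T -> 'I_n -> R).
Hypothesis mx : forall i, measurable_fun setT (fun t => x t i).

Lemma measurable_block j i :
  measurable_fun setT (fun t => ((@block R k h j) (x t i))%:R : R).
Proof.
have -> : (fun t => ((@block R k h j) (x t i))%:R : R) =
    (fun t => \1_(`]j.*2%:R * (h / k.*2.+1%:R),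
      j.*2.+1%:R * (h / k.*2.+1%:R)]%classic : set R) (x t i)).
  apply/funext => t; rewrite indicE; congr (nat_of_bool _)%:R.
  by rewrite mem_setE in_itv.
apply: measurableT_comp => //; exact: measurable_indic.
Qed.

Lemma measurable_block_count j :
  measurable_fun setT (fun t => block_count (@block R k h) (x t) j).
Proof. by apply: measurable_sum => i; exact: measurable_block. Qed.

Let min_blocks phi :
  measurable_fun setT (fun t => in_blocks (@block R k h) (x t) phi).
Proof. by apply: measurable_prod => j _; exact: measurable_block. Qed.

Lemma measurable_weight i :
  measurable_fun setT (fun t => weight (@block R k h) (x t) i).
Proof.
apply: measurable_funM.
  apply: measurableT_comp; first exact: measurable_invr.
  by apply: measurable_sum.
apply: measurable_sum => phi; apply: measurable_funM => //.
apply: measurable_sum => j; apply: measurable_funM => //.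
under eq_fun do rewrite /lag big_mkcond/=.
apply: measurable_prod => l _; case: (l != j); last exact: measurable_cst.
apply: measurable_funM.
  by apply: measurable_funB => //; exact: mx.
apply: measurableT_comp; first exact: measurable_invr.
by apply: measurable_funB; exact: mx.
Qed.

Lemma measurable_full_blocks : measurable_fun setT (fun t => full_blocks (x t)).
Proof.
apply: measurable_prod => j _.
have -> : (fun t => (m <= block_count (@block R k h) (x t) j)%R%:R : R) =
    (fun t => \1_(`[m, +oo[%classic : set R) (block_count (@block R k h) (x t) j)).
  apply/funext => t; rewrite indicE; congr (nat_of_bool _)%:R.
  by rewrite mem_setE in_itv/= andbT.
apply: measurableT_comp; [exact: measurable_indic|exact: measurable_block_count].
Qed.

End measurability.

Let measurable_est : measurable_fun setT est.
Proof.
have mt (i : 'I_n) : measurable_fun setT (fun z : n.-tuple (R * R) => tnth z i).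
  exact: measurable_tnth.
have m1 i : measurable_fun setT (fun z : n.-tuple (R * R) => offsets z i).
  apply: measurable_funB => //.
  by apply: (measurableT_comp measurable_fst); exact: mt.
apply: measurable_funM; first exact: measurable_full_blocks.
apply: measurable_sum => i; apply: measurable_funM; first exact: measurable_weight.
by apply: (measurableT_comp measurable_snd); exact: mt.
Qed.

HB.instance Definition _ := isMeasurableFun.Build _ _ _ _ est measurable_est.

Lemma full_blocksP (x : 'I_n -> R) :
  full_blocks x = 1 /\ (forall j, m <= block_count (@block R k h) x j) \/
  full_blocks x = 0 /\ exists j, block_count (@block R k h) x j < m.
Proof.
have [H|/forallPn[j]] := boolP [forall j, m <= block_count (@block R k h) x j].
  left; split; last by move/forallP : H.
  by rewrite /full_blocks big1// => j _; rewrite (forallP H).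
rewrite -ltNge => jm; right; split; last by exists j.
by rewrite /full_blocks (bigD1 j)//= leNgt jm mul0r.
Qed.

End estimator.

(** * Risk of the estimator *)

Section estimation_error.
Context (R : realType) (k n : nat) (p x0 h m r alpha : R).
Hypotheses (p0 : 0 < p) (h0 : 0 < h) (m0 : 0 < m) (r0 : 0 < r).
Hypothesis alpha0 : 0 <= alpha.

Definition wsum_cst : R := k.+1%:R * lag_cst R k.

(** Bound of the bias of the estimator, in units of r. *)
Definition bias_cst : R := 2 * (wsum_cst + 1).

Lemma lag_cst_ge0 : 0 <= lag_cst R k.
Proof. by rewrite /lag_cst exprn_ge0. Qed.

Lemma wsum_cst_ge0 : 0 <= wsum_cst.
Proof. by rewrite mulr_ge0// lag_cst_ge0. Qed.

(** When all blocks are full the weights reproduce P, so the error is the weighted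
sum of f - P, plus the error of P at x0, plus the noise r * S. Powers are bounded
by exponentials because the noise is Gaussian given the design. *)
Lemma est_error (f : R -> R) (P : {poly R}) (x y w : 'I_n -> R) (S : R) :
  (size P <= k.+1)%N -> `|f x0 - P.[0]| <= 2 * r ->
  (forall t, (exists j, @block R k h j t) -> `|f (x0 + t) - P.[t]| <= 2 * r) ->
  `|f x0| <= alpha ->
  w = weight (@block R k h) x -> S = \sum_(i < n) w i / r * y i ->
  `|full_blocks k h m x * (\sum_(i < n) w i * (f (x0 + x i) + y i)) - f x0| `^ p <=
  full_blocks k h m x * (r `^ p * (pow_cst p * expR bias_cst) * (expR S + expR (- S)))
  + (1 - full_blocks k h m x) * alpha `^ p.
Proof.
move=> sP fP0 fPt fa wE SE.
have [[-> full]|[-> _]] := full_blocksP k h m x; last first.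
  rewrite mul0r sub0r normrN mul0r add0r subr0 mul1r.
  by apply: ge0_ler_powR; rewrite ?nnegrE ?(ltW p0).
rewrite !mul1r subrr mul0r addr0.
have lagB phi j := @block_lag R k n x h h0 phi j.
have injB phi := @block_injective R k n x h h0 phi.
have wP := weight_poly m0 full sP injB; rewrite -wE in wP.
have decomp : \sum_(i < n) w i * (f (x0 + x i) + y i) - f x0 =
    \sum_(i < n) w i * (f (x0 + x i) - P.[x i]) + (P.[0] - f x0) + r * S.
  rewrite -wP SE mulr_sumr addrAC addrA -!big_split/=.
  congr (_ - _); apply: eq_bigr => i _.
  by rewrite [r * _]mulrCA mulrA; field; rewrite gt_eqF.
have err : `|\sum_(i < n) w i * (f (x0 + x i) + y i) - f x0| <=
    r * (bias_cst + `|S|).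
  rewrite decomp; apply: le_trans (ler_normD _ _) _.
  rewrite normrM (gtr0_norm r0) mulrDr lerD2r.
  apply: le_trans (ler_normD _ _) _.
  have b1 : `|\sum_(i < n) w i * (f (x0 + x i) - P.[x i])| <= wsum_cst * (2 * r).
    apply: le_trans (ler_norm_sum _ _ _) _.
    under eq_bigr do rewrite normrM.
    rewrite wE /wsum_cst.
    apply: (sum_weight_le m0 full lagB (g := fun i => f (x0 + x i) - P.[x i])).
      by rewrite mulr_ge0// ltW.
    by move=> i j bj; apply: fPt; exists j.
  have b2 : `|P.[0] - f x0| <= 2 * r by rewrite distrC.
  by rewrite /bias_cst; lra.
have bS : 0 <= bias_cst + `|S|.
  by rewrite addr_ge0// mulr_ge0// addr_ge0// wsum_cst_ge0.
apply: (@le_trans _ _ ((r * (bias_cst + `|S|)) `^ p)).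
  apply: ge0_ler_powR; rewrite ?nnegrE ?(ltW p0)//.
  by rewrite mulr_ge0// ltW.
rewrite powRM ?(ltW r0)// -mulrA ler_wpM2l ?powR_ge0//.
apply: le_trans (powR_le_expR p0 bS) _.
rewrite expRD -!mulrA ler_wpM2l ?ler0n// ler_wpM2l ?expR_ge0//.
have [S0|S0] := leP 0 S; first by rewrite (ger0_norm S0) lerDl expR_ge0.
by rewrite (ltr0_norm S0) lerDr expR_ge0.
Qed.

End estimation_error.

Section chernoff.
Context (R : realType).

(** Markov's inequality for exp (- N). *)
Lemma count_lt_le (k n : nat) (h m : R) (x : 'I_n -> R) :
  1 - full_blocks k h m x <=
  \sum_(j < k.+1) expR m * \prod_(i < n) expR (- (@block R k h j (x i))%:R).
Proof.
have pos j : 0 <= expR m * \prod_(i < n) expR (- (@block R k h j (x i))%:R).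
  by rewrite mulr_ge0 ?expR_ge0//; apply: prodr_ge0 => i _; exact: expR_ge0.
have [[-> _]|[-> [j jm]]] := full_blocksP k h m x.
  by rewrite subrr sumr_ge0.
rewrite subr0 (bigD1 j)//= ler_wpDr ?sumr_ge0//.
rewrite -expR_sum -expRD sumrN -[leLHS]expR0 ler_expR subr_ge0.
exact: ltW.
Qed.

Lemma integral_expN_block (mu : design_density R) (k : nat) (x0 h q : R)
    (j : 'I_k.+1) :
  design_law mu `]x0 + j.*2%:R * (h / k.*2.+1%:R),
                  x0 + j.*2.+1%:R * (h / k.*2.+1%:R)] = q%:E ->
  (\int[design_law mu]_x (expR (- (@block R k h j (x - x0))%:R))%:E =
   (1 - q * (1 - expR (- 1)))%:E)%E.
Proof.
move=> qE; set A := (X in design_law mu X) in qE.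
have mA : measurable A by exact: measurable_itv.
have bA x : (@block R k h j (x - x0)) = (x \in A).
  by rewrite /block mem_setE in_itv/= ltrBrDl lerBlDl.
transitivity (\int[design_law mu]_x
    ((expR (-1))%:E * (\1_A x)%:E + (\1_(~` A) x)%:E))%E.
  apply: eq_integral => x _; rewrite bA -EFinM -EFinD !indicE in_setC.
  by case: (x \in A); rewrite /= ?oppr0 ?expR0 ?mulr1 ?mulr0 ?addr0 ?add0r.
have mI (B : set R) : measurable B ->
    measurable_fun [set: measurableTypeR R] (fun x => (\1_B x)%:E : \bar R).
  by move=> mB; apply/measurable_EFinP; exact: measurable_indic.
have I0 (B : set R) x : (0 <= (\1_B x)%:E :> \bar R)%E by rewrite lee_fin.
have e0 : (0 <= (expR (-1))%:E :> \bar R)%E by rewrite lee_fin expR_ge0.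
have mAI := mI _ mA; have mCI := mI _ (measurableC mA).
rewrite (ge0_integralD (design_law mu) measurableT
  (fun x _ => mule_ge0 e0 (I0 A x)) _ (fun x _ => I0 (~` A) x) mCI); last first.
  exact: emeasurable_funM.
rewrite (ge0_integralZl (design_law mu) measurableT mAI (fun x _ => I0 A x))//.
rewrite !integral_indic//; last exact: measurableC.
rewrite !setIT.
transitivity ((expR (-1))%:E * q%:E + (1 - q%:E))%E.
  congr (_ * _ + _)%E; first exact: qE.
  by rewrite -qE; exact: probability_setC.
by rewrite -EFinM -EFinB -EFinD; congr EFin; lra.
Qed.

End chernoff.

Section estimator_risk.
Context (R : realType) (k n : nat) (p sigma x0 h m r alpha C1 : R).
Context (mu : design_density R) (q : 'I_k.+1 -> R).
Hypotheses (p0 : 0 < p) (sigma0 : 0 < sigma) (h0 : 0 < h) (m0 : 0 < m).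
Hypotheses (r0 : 0 < r) (alpha0 : 0 <= alpha).
Hypothesis noise : sigma ^+ 2 / r ^+ 2 <= C1 * m.
Hypothesis qE : forall j : 'I_k.+1,
  design_law mu `]x0 + j.*2%:R * (h / k.*2.+1%:R),
                  x0 + j.*2.+1%:R * (h / k.*2.+1%:R)] = (q j)%:E.
Hypothesis qm : forall j, 4 * m <= n%:R * q j.

Definition risk_cst : R :=
  pow_cst p * expR (bias_cst R k) * (2 * expR (wsum_cst R k ^+ 2 * C1 / 2)).

Lemma iid_normal_expR (t : 'I_n -> R) :
  (\int[iid_law (normal_prob 0 sigma) n]_y
     (expR (\sum_(i < n) t i * tnth y i))%:E =
   (expR (\sum_(i < n) t i ^+ 2 * sigma ^+ 2 / 2))%:E)%E.
Proof.
have s0 : sigma != 0 by rewrite gt_eqF.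
rewrite expR_sum.
transitivity (\int[iid_law (normal_prob 0 sigma) n]_y
    (\prod_(i < n) expR (t i * tnth y i))%:E)%E.
  by apply: eq_integral => y _; rewrite expR_sum.
apply: (@integral_iid_prod _ _ _ (normal_prob 0 sigma) n
  (fun i y => expR (t i * y)) (fun i => expR (t i ^+ 2 * sigma ^+ 2 / 2))).
- move=> i; apply: measurableT_comp => //.
- by move=> i y; exact: expR_ge0.
- by move=> i; exact: integral_normal_expR.
Qed.

Lemma noise_weights (x : 'I_n -> R) : full_blocks k h m x = 1 ->
  \sum_(i < n) (weight (@block R k h) x i / r) ^+ 2 * sigma ^+ 2 / 2 <=
  wsum_cst R k ^+ 2 * C1 / 2.
Proof.
case: (full_blocksP k h m x) => [[_ full] _|[-> _] /eqP]; last first.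
  by rewrite eq_sym oner_eq0.
have lagB phi j := @block_lag R k n x h h0 phi j.
have sw := sum_weight_sqr m0 (@lag_cst_ge0 R k) full lagB.
rewrite -/(wsum_cst R k) in sw.
have -> : \sum_(i < n) (weight (@block R k h) x i / r) ^+ 2 * sigma ^+ 2 / 2 =
    (\sum_(i < n) weight (@block R k h) x i ^+ 2) * (sigma ^+ 2 / r ^+ 2) / 2.
  rewrite !mulr_suml; apply: eq_bigr => i _.
  by field; rewrite gt_eqF.
rewrite ler_pM2r ?invr_gt0//.
apply: (@le_trans _ _ (wsum_cst R k ^+ 2 / m * (C1 * m))).
  apply: ler_pM; [|by rewrite divr_ge0 ?sqr_ge0|exact: sw|exact: noise].
  by apply: sumr_ge0 => i _; exact: sqr_ge0.
by rewrite le_eqVlt; apply/orP; left; apply/eqP; field; rewrite gt_eqF.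
Qed.

Lemma inner_risk (f : R -> R) (P : {poly R}) (x : 'I_n -> R) :
  (size P <= k.+1)%N -> `|f x0 - P.[0]| <= 2 * r ->
  (forall t, (exists j, @block R k h j t) -> `|f (x0 + t) - P.[t]| <= 2 * r) ->
  `|f x0| <= alpha ->
  (\int[iid_law (normal_prob 0 sigma) n]_y
    (`|full_blocks k h m x * (\sum_(i < n) weight (@block R k h) x i *
       (f (x0 + x i) + tnth y i)) - f x0| `^ p)%:E <=
  (r `^ p * risk_cst + (1 - full_blocks k h m x) * alpha `^ p)%:E)%E.
Proof.
move=> sP fP0 fPt fa.
pose G := full_blocks k h m x; pose w := weight (@block R k h) x.
pose S (y : n.-tuple R) := \sum_(i < n) w i / r * tnth y i.
have mt (i : 'I_n) : measurable_fun setT (fun y : n.-tuple R => tnth y i).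
  exact: measurable_tnth.
have mS : measurable_fun setT S.
  by apply: measurable_sum => i; apply: measurable_funM => //; exact: mt.
have G01 : 0 <= G <= 1.
  by case: (full_blocksP k h m x) => -[e _]; rewrite /G e ?lexx ler01.
pose a := G * (r `^ p * (pow_cst p * expR (bias_cst R k))).
have a0 : 0 <= a.
  rewrite /a mulr_ge0//; first by case/andP : G01.
  by rewrite mulr_ge0 ?powR_ge0// mulr_ge0 ?expR_ge0// ler0n.
pose c := (1 - G) * alpha `^ p.
have c0 : 0 <= c.
  by rewrite mulr_ge0 ?powR_ge0// subr_ge0; case/andP : G01.
apply: (@le_trans _ _ (\int[iid_law (normal_prob 0 sigma) n]_y
    (a%:E * ((expR (S y))%:E + (expR (- S y))%:E) + c%:E))%E).
  apply: ge0_le_integral => //.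
  - apply/measurable_EFinP.
    apply: (@measurableT_comp _ _ _ _ _ _ (@powR R ^~ p)) => //.
    apply: measurableT_comp => //; apply: measurable_funB => //.
    apply: measurable_funM => //; apply: measurable_sum => i.
    apply: measurable_funM => //; apply: measurable_funD => //; exact: mt.
  - apply: emeasurable_funD => //; apply: emeasurable_funM => //.
    apply: emeasurable_funD; apply/measurable_EFinP; apply: measurableT_comp => //.
    exact: measurableT_comp.
  - move=> y _; rewrite [leRHS](_ : _ =
      (a * (expR (S y) + expR (- S y)) + c)%:E) ?lee_fin; last first.
      by [].
    have := @est_error R k n p x0 h m r alpha p0 h0 m0 r0 alpha0 f P x (tnth y) w (S y)
      sP fP0 fPt fa erefl erefl.
    move=> /le_trans; apply; rewrite -/G lerD2r /a mulrA.
    by rewrite mulrA.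
have E1 := iid_normal_expR (fun i => w i / r).
have E2 := iid_normal_expR (fun i => - (w i / r)).
set v := \sum_(i < n) (w i / r) ^+ 2 * sigma ^+ 2 / 2 in E1.
have {}E2 : (\int[iid_law (normal_prob 0 sigma) n]_y (expR (- S y))%:E = (expR v)%:E)%E.
  rewrite (_ : v = \sum_(i < n) (- (w i / r)) ^+ 2 * sigma ^+ 2 / 2); last first.
    by apply: eq_bigr => i _; rewrite sqrrN.
  rewrite -E2; apply: eq_integral => y _; rewrite /S -sumrN.
  by congr (expR _)%:E; apply: eq_bigr => i _; rewrite mulNr.
have m1 : measurable_fun setT (fun y => (expR (S y))%:E).
  by apply/measurable_EFinP; exact: measurableT_comp.
have m2 : measurable_fun setT (fun y => (expR (- S y))%:E).
  by apply/measurable_EFinP; apply: measurableT_comp => //; exact: measurableT_comp.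
have p1 y : (0 <= (expR (S y))%:E)%E by rewrite lee_fin expR_ge0.
have p2 y : (0 <= (expR (- S y))%:E)%E by rewrite lee_fin expR_ge0.
have a0E : (0 <= a%:E)%E by rewrite lee_fin.
have c0E : (0 <= c%:E)%E by rewrite lee_fin.
have m12 := emeasurable_funD m1 m2.
pose N := iid_law (normal_prob 0 sigma) n.
rewrite (ge0_integralD N measurableT
  (fun y _ => mule_ge0 a0E (adde_ge0 (p1 y) (p2 y))) (emeasurable_funM (measurable_cst _) m12)
  (fun y _ => c0E) (measurable_cst _)).
rewrite (ge0_integralZl N measurableT m12 (fun y _ => adde_ge0 (p1 y) (p2 y)))//.
rewrite (ge0_integralD N measurableT (fun y _ => p1 y) m1 (fun y _ => p2 y) m2).
rewrite E1 E2 integral_cst// -[X in (_ + _ * X <= _)%E]/(N [set: _]) probability_setT mule1.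
rewrite [leLHS](_ : _ = (a * (expR v + expR v) + c)%:E)// lee_fin -/G -/c lerD2r.
have [[G1 full]|[G0 _]] := full_blocksP k h m x; last first.
  rewrite /a /G G0 !mul0r mulr_ge0 ?powR_ge0// /risk_cst.
  by rewrite !mulr_ge0 ?expR_ge0// ler0n.
rewrite /a /G G1 mul1r /risk_cst; set E := expR (_ / 2).
have vE : expR v <= E by rewrite ler_expR; exact: noise_weights.
rewrite -!mulrA ler_wpM2l ?powR_ge0// ler_wpM2l ?ler0n// ler_wpM2l ?expR_ge0//.
by lra.
Qed.

(** At least 4 m points are expected in block j while only m are asked for, and
1 - expR (-1) >= 1/2. *)
Lemma chernoff_block j :
  expR m * (1 - q j * (1 - expR (- 1))) ^+ n <= expR (- m).
Proof.
have e2 := @expR_N1_le R; have e0 := expR_ge0 (- 1 : R).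
have q0 : 0 <= q j by rewrite -lee_fin -qE measure_ge0.
have q1 : q j <= 1 by rewrite -lee_fin -qE; exact: probability_le1.
set u := q j * (1 - expR (-1)).
have u1 : 0 <= 1 - u by rewrite /u; nra.
apply: (@le_trans _ _ (expR m * (expR (- u)) ^+ n)).
  rewrite ler_wpM2l ?expR_ge0// lerXn2r// ?nnegrE ?expR_ge0//.
  exact: expR_ge1Dx.
rewrite -expRM_natl -expRD ler_expR.
have : n%:R * q j * 2^-1 <= n%:R * q j * (1 - expR (-1)).
  by rewrite ler_wpM2l ?mulr_ge0//; lra.
have := qm j; rewrite mulrN /u mulrA; lra.
Qed.

(** [inner_risk] integrates the noise given the design; integrating the design,
the event that some block is not full is bounded by [count_lt_le]. *)
Lemma est_risk (f : {mfun R >-> R}) (P : {poly R}) :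
  (size P <= k.+1)%N -> `|f x0 - P.[0]| <= 2 * r ->
  (forall t, (exists j, @block R k h j t) -> `|f (x0 + t) - P.[t]| <= 2 * r) ->
  `|f x0| <= alpha ->
  (\int[sample_law f mu sigma n]_z (`|est k x0 h m z - f x0| `^ p)%:E <=
   (r `^ p * risk_cst + alpha `^ p * (k.+1%:R * expR (- m)))%:E)%E.
Proof.
move=> sP fP0 fPt fa.
have mF : measurable_fun setT
    (fun z : n.-tuple (R * R) => (`|est k x0 h m z - f x0| `^ p)%:E).
  apply/measurable_EFinP.
  apply: (@measurableT_comp _ _ _ _ _ _ (@powR R ^~ p)) => //.
  by apply: measurableT_comp => //; exact: measurable_funB.
have F0 (z : n.-tuple (R * R)) : (0 <= (`|est k x0 h m z - f x0| `^ p)%:E)%E.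
  by rewrite lee_fin powR_ge0.
rewrite (integral_iid_zip (observe f) (design_law mu) (normal_prob 0 sigma) mF F0).
pose xs (X : n.-tuple R) (i : 'I_n) := tnth X i - x0.
pose ck j (X : n.-tuple R) : R := \prod_(i < n) expR (- (@block R k h j (xs X i))%:R).
have mxs i : measurable_fun setT (fun X => xs X i).
  by apply: measurable_funB => //; exact: measurable_tnth.
have mck j : measurable_fun setT (ck j).
  apply: measurable_prod => i _; apply: measurableT_comp => //.
  by apply: measurableT_comp => //; exact: measurable_block.
have ck0 j X : 0 <= ck j X by apply: prodr_ge0 => i _; exact: expR_ge0.
have c0 : 0 <= alpha `^ p * expR m by rewrite mulr_ge0 ?powR_ge0 ?expR_ge0.
have rc0 : 0 <= r `^ p * risk_cst.
  by rewrite /risk_cst !mulr_ge0 ?powR_ge0 ?expR_ge0// ler0n.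
have mckE j : measurable_fun setT (fun X => (alpha `^ p * expR m)%:E * (ck j X)%:E)%E.
  by apply: emeasurable_funM => //; exact/measurable_EFinP.
have ckE0 j X : (0 <= (alpha `^ p * expR m)%:E * (ck j X)%:E)%E.
  by rewrite mule_ge0// lee_fin.
apply: (@le_trans _ _ (\int[iid_law (design_law mu) n]_X
   ((r `^ p * risk_cst)%:E +
     \sum_(j < k.+1) (alpha `^ p * expR m)%:E * (ck j X)%:E))%E).
  apply: ge0_le_integral => //.
  - by move=> X _; exact: integral_ge0.
  - have mFz : measurable_fun setT (fun u : n.-tuple R * n.-tuple R =>
        (`|est k x0 h m (zip_with (observe f) u.1 u.2) - f x0| `^ p)%:E).
      exact: (measurableT_comp mF (@measurable_zip_with _ _ _ _ _ _ (observe f) n)).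
    exact: (measurable_fun_fubini_tonelli_F (m2 := iid_law (normal_prob 0 sigma) n) _ mFz).
  - apply: emeasurable_funD => //.
    exact: emeasurable_sum.
  - move=> X _.
    have offX (Y : n.-tuple R) : offsets x0 (zip_with (observe f) X Y) = xs X.
      by apply/funext => i; rewrite /offsets tnth_mktuple.
    have -> : (\int[iid_law (normal_prob 0 sigma) n]_y
        (`|est k x0 h m (zip_with (observe f) X y) - f x0| `^ p)%:E =
      \int[iid_law (normal_prob 0 sigma) n]_y
        (`|full_blocks k h m (xs X) * (\sum_(i < n) weight (@block R k h) (xs X) i *
          (f (x0 + xs X i) + tnth y i)) - f x0| `^ p)%:E)%E.
      apply: eq_integral => Y _; rewrite /est offX.
      congr ((`|_ * _ - _| `^ p)%:E); apply: eq_bigr => i _.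
      by rewrite tnth_mktuple/= /xs [x0 + _]addrC subrK.
    apply: le_trans (inner_risk (xs X) sP fP0 fPt fa) _.
    rewrite (eq_bigr (fun j => (alpha `^ p * expR m * ck j X)%:E)); last by [].
    rewrite sumEFin -EFinD lee_fin lerD2l mulrC.
    have := @count_lt_le R k n h m (xs X).
    move=> /(ler_wpM2l (powR_ge0 alpha p)) /le_trans; apply.
    by rewrite mulr_sumr; apply: ler_sum => j _; rewrite mulrA.
have sum0 X : (0 <= \sum_(j < k.+1) (alpha `^ p * expR m)%:E * (ck j X)%:E)%E.
  by apply: sume_ge0 => j _.
pose Q := iid_law (design_law mu) n.
have rc0E : (0 <= (r `^ p * risk_cst)%:E)%E by rewrite lee_fin.
have msum : measurable_fun setT
    (fun X => \sum_(j < k.+1) (alpha `^ p * expR m)%:E * (ck j X)%:E)%E.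
  exact: emeasurable_sum.
rewrite (ge0_integralD Q measurableT (fun X _ => rc0E) (measurable_cst _)
  (fun X _ => sum0 X) msum).
rewrite integral_cst// -[X in (_ * X + _ <= _)%E]/(Q [set: _]) probability_setT mule1.
rewrite EFinD leeD2l// (ge0_integral_sum Q measurableT)//.
have -> : (alpha `^ p * (k.+1%:R * expR (- m)))%:E =
    (\sum_(j < k.+1) (alpha `^ p * expR (- m))%:E)%E.
  by rewrite sumEFin sumr_const card_ord mulrCA mulr_natl.
apply: lee_sum => j _.
have mckj : measurable_fun setT (fun X => (ck j X)%:E) by exact/measurable_EFinP.
have ckjE0 X : (0 <= (ck j X)%:E)%E by rewrite lee_fin.
rewrite (ge0_integralZl Q measurableT mckj (fun X _ => ckjE0 X)) ?lee_fin//.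
have mb x : measurable_fun [set: R] (fun t => expR (- (@block R k h j (t - x))%:R : R)).
  apply: measurableT_comp => //; apply: measurableT_comp => //.
  have mx : forall i : 'I_1, measurable_fun [set: R] (fun t : R => t - x).
    by move=> _; exact: measurable_funB.
  exact: (@measurable_block R k 1 h _ R (fun t _ => t - x) mx j ord0).
have -> : (\int[Q]_X (ck j X)%:E = ((1 - q j * (1 - expR (- 1))) ^+ n)%:E)%E.
  have := @integral_iid_prod _ _ _ (design_law mu) n
    (fun=> fun t => expR (- (@block R k h j (t - x0))%:R : R))
    (fun=> 1 - q j * (1 - expR (- 1))).
  rewrite prodr_const card_ord; apply => //.
    by move=> _; exact: mb.
  by move=> _; apply: integral_expN_block; exact: qE.
by rewrite -EFinM lee_fin -mulrA ler_wpM2l ?powR_ge0// chernoff_block.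
Qed.

End estimator_risk.

(** * Asymptotics along the bandwidth *)

Section block_mass.
Context (R : realType).

(** The right-hand side is equivalent to the difference of the powers of b and a
with exponent beta + 1, times cumul nu h. *)
Lemma cumul_ratio_gap beta (a b : R) : -1 < beta -> 0 <= a -> a < b ->
  exists2 kap, 0 < kap & forall nu : R -> R, RV beta nu ->
    (exists2 d, 0 < d & (\int[@lebesgue_measure R]_(t in `]0%R, d]) (nu t)%:E < +oo)%E) ->
    \forall h \near 0^'+,
      kap * cumul nu h <= cumul nu (b * h) - cumul nu (a * h).
Proof.
move=> beta1 a0 ab; have b0 : 0 < b by exact: le_lt_trans ab.
have be : 0 < beta + 1 by lra.
have gap : a `^ (beta + 1) < b `^ (beta + 1).
  by apply: gt0_ltr_powR => //; rewrite nnegrE// ltW.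
exists ((b `^ (beta + 1) - a `^ (beta + 1)) / 4); first by rewrite divr_gt0// subr_gt0.
set e := _ / 4 => nu nubeta nuint.
have e4 : b `^ (beta + 1) - a `^ (beta + 1) = 4 * e by rewrite /e; field.
have e0 : 0 < e by rewrite /e divr_gt0// subr_gt0.
have VRV := cumul_RV nubeta nuint.
have [d1 d10 d1P] : exists2 d, 0 < d & forall h, 0 < h < d ->
    (b `^ (beta + 1) - e) * cumul nu h < cumul nu (b * h) <
    (b `^ (beta + 1) + e) * cumul nu h.
  by apply: (RV_ratio VRV) => //; lra.
have [d2 d20 d2P] : exists2 d, 0 < d & forall h, 0 < h < d ->
    cumul nu (a * h) <= (a `^ (beta + 1) + e) * cumul nu h.
  have [a1|a1] := ltP 0 a; last first.
    have -> : a = 0 by apply/eqP; rewrite eq_le a1 a0.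
    exists 1 => // h /andP[h0 _]; rewrite mul0r cumul0.
    by rewrite mulr_ge0 ?addr_ge0 ?powR_ge0// ?ltW// (cumul_gt0 nubeta).
  have [d d0 dP] : exists2 d, 0 < d & forall h, 0 < h < d ->
      -1 * cumul nu h < cumul nu (a * h) < (a `^ (beta + 1) + e) * cumul nu h.
    by apply: (RV_ratio VRV) => //; have := powR_ge0 a (beta + 1); lra.
  by exists d => // h /dP/andP[_ /ltW].
apply/near0rP; exists (Num.min d1 d2) => [|h]; first by rewrite lt_min d10.
rewrite lt_min => /andP[h0 /andP[hd1 hd2]].
have /andP[l1 _] := d1P h (introT andP (conj h0 hd1)).
have l2 := d2P h (introT andP (conj h0 hd2)).
have Vh := cumul_gt0 nubeta nuint h0.
have : b `^ (beta + 1) = a `^ (beta + 1) + 4 * e by lra.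
move=> E; rewrite E in l1.
have := mulr_gt0 e0 Vh; nra.
Qed.

(** For beta = -1 the mass is so concentrated at x0 that V (h / 2) is equivalent
to V h: only a block that starts at x0 keeps a fixed share of the window, which
is enough for k = 0. *)
Lemma block_mass beta (k : nat) : (-1 < beta) \/ (beta = -1 /\ k = 0%N) ->
  exists2 kap, 0 < kap & forall nu : R -> R, RV beta nu ->
    (exists2 d, 0 < d & (\int[@lebesgue_measure R]_(t in `]0%R, d]) (nu t)%:E < +oo)%E) ->
    \forall h \near 0^'+, forall j : 'I_k.+1,
      kap * cumul nu h <= cumul nu (j.*2.+1%:R * (h / k.*2.+1%:R)) -
                          cumul nu (j.*2%:R * (h / k.*2.+1%:R)).
Proof.
case=> [beta1|[-> ->]]; last first.
  exists 1 => // nu nubeta nuint; near=> h => j.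
  by rewrite (ord1 j) /= mul0r cumul0 subr0 divr1 !mul1r.
have gap (j : 'I_k.+1) : exists kap, 0 < kap /\ forall nu : R -> R, RV beta nu ->
    (exists2 d, 0 < d & (\int[@lebesgue_measure R]_(t in `]0%R, d]) (nu t)%:E < +oo)%E) ->
    \forall h \near 0^'+,
      kap * cumul nu h <= cumul nu (j.*2.+1%:R / k.*2.+1%:R * h) -
                          cumul nu (j.*2%:R / k.*2.+1%:R * h).
  have [|kap kap0 kapP] := @cumul_ratio_gap beta (j.*2%:R / k.*2.+1%:R)
      (j.*2.+1%:R / k.*2.+1%:R) beta1 (divr_ge0 (ler0n _ _) (ler0n _ _)).
    by rewrite ltr_pM2r ?invr_gt0// ltr_nat.
  by exists kap.
have [kaps kapsP] := choice gap.
pose kap := \big[Num.min/1]_(j < k.+1) kaps j.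
have kap_le j : kap <= kaps j by exact: bigmin_le_cond.
exists kap.
  by apply: lt_bigmin => // j _; have [] := kapsP j.
move=> nu nubeta nuint.
have : \forall h \near 0^'+, forall j : 'I_k.+1,
    kaps j * cumul nu h <= cumul nu (j.*2.+1%:R / k.*2.+1%:R * h) -
                           cumul nu (j.*2%:R / k.*2.+1%:R * h).
  by apply: filter_forall => j; have [_] := kapsP j; exact.
apply: filter_app; near=> h => H j.
have h0 : 0 < h by near: h; exact: nbhs_right_gt.
rewrite [h / _]mulrC !mulrA; apply: le_trans (H j).
by rewrite ler_wpM2r// ltW// (cumul_gt0 nubeta).
Unshelve. all: by end_near. Qed.

End block_mass.

Section negligible.
Context (R : realType) (s beta sigma : R) (omega nu : R -> R) (h : nat -> R).
Hypotheses (s0 : 0 < s) (beta1 : -1 <= beta) (sigma0 : 0 < sigma).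
Hypotheses (omegas : RV s omega) (nubeta : RV beta nu).
Hypothesis nuint : exists2 d, 0 < d &
  (\int[@lebesgue_measure R]_(t in `]0%R, d]) (nu t)%:E < +oo)%E.
Hypothesis hn : \forall n \near \oo, smallest_bandwidth sigma omega nu n (h n).

Let hsmall := bandwidth_cvg0 s0 beta1 omegas nubeta nuint sigma0 hn.

Lemma rate_small (e : R) : 0 < e -> \forall n \near \oo, 0 < omega (h n) < e.
Proof.
move=> e0; have [d d0 dP] := RV_cvg0 omegas s0 e0.
apply: filterS (hsmall d0) => n /andP[h0 hd].
by rewrite (RV_gt0 omegas h0) dP// h0.
Qed.

(** For this a, omega^a / V is regularly varying with index 1 and tends to 0; the
bandwidth equation expresses n through omega and V. *)
Lemma rate_power : exists2 a : R, 0 < a &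
  \forall n \near \oo, n%:R <= omega (h n) `^ (- a).
Proof.
pose a := (beta + 2) / s.
have a0 : 0 < a by rewrite divr_gt0//; move: beta1; lra.
have rv : RV 1 (fun t => omega t `^ a * cumul nu t `^ (-1)).
  have E : s * a + (beta + 1) * (-1) = 1 by rewrite /a; field; rewrite gt_eqF.
  by have := RV_mul (RV_pow a omegas) (RV_pow (-1) (cumul_RV nubeta nuint)); rewrite E.
have e0 : 0 < 2 / sigma ^+ 2 by rewrite divr_gt0// exprn_gt0.
have [d d0 dP] := RV_cvg0 rv ltr01 e0.
exists (a + 2); first by rewrite addr_gt0.
have hd := hsmall d0.
near=> n.
have n0 : (0 < n)%N by near: n; exact: nbhs_infty_gt.
have nR : 0 < n%:R :> R by rewrite ltr0n.
have [hp heq _] : smallest_bandwidth sigma omega nu n (h n) by near: n.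
have hnd : 0 < h n < d by near: n.
have Gn := (bandwidthP omegas nubeta nuint sigma0 n0 hp).1 heq.
have oh := RV_gt0 omegas hp; have Vh := cumul_gt0 nubeta nuint hp.
have := dP _ hnd; rewrite powR_inv1 ?(ltW Vh)// => small.
rewrite powRN -[leRHS]mul1r ler_pdivlMr ?powR_gt0//.
have -> : omega (h n) `^ (a + 2) = omega (h n) `^ a * omega (h n) ^+ 2.
  by rewrite powRD ?powR_mulrn ?(ltW oh)// (gt_eqF oh) implybT.
have nE : n%:R = sigma ^+ 2 / (2 * info omega nu (h n)).
  by rewrite Gn; field; rewrite !gt_eqF.
rewrite nE /info.
have -> : sigma ^+ 2 / (2 * (omega (h n) * omega (h n) * cumul nu (h n))) *
    (omega (h n) `^ a * omega (h n) ^+ 2) =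
    (sigma ^+ 2 / 2) * (omega (h n) `^ a / cumul nu (h n)).
  by field; rewrite !gt_eqF.
rewrite -ler_pdivlMl ?divr_gt0 ?exprn_gt0// mulr1 invf_div.
exact: ltW.
Unshelve. all: by end_near. Qed.

(** Let w = omega (h n). The exponential is smaller than any power of w, whereas
alpha n is at most a power of w^-1, by [rate_power]. *)
Lemma tail_negligible (p gamma kap K : R) (alpha : nat -> R) :
  0 < p -> 0 < gamma -> 0 < kap -> 0 < K -> (forall n, 0 < alpha n) ->
  alpha =O_\oo (fun n => n%:R `^ gamma) ->
  \forall n \near \oo,
    alpha n `^ p * (K * expR (- (kap * (sigma ^+ 2 / omega (h n) ^+ 2)))) <=
    omega (h n) `^ p.
Proof.
move=> p0 g0 kap0 K0 al0 /eqO_exP[A A0 alA].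
have [a a0 an] := rate_power.
pose b := a * gamma * p; have b0 : 0 < b by rewrite !mulr_gt0.
(* one power of w more than needed, to absorb the constant C *)
pose q := (b + p + 1) / 2; have q0 : 0 < q by rewrite divr_gt0// !addr_gt0.
pose C := A `^ p * K * pow_cst q * (kap * sigma ^+ 2) `^ (- q).
have ks0 : 0 < kap * sigma ^+ 2 by rewrite mulr_gt0// exprn_gt0.
have pc0 : 0 < pow_cst q by rewrite /pow_cst ltr0n fact_gt0.
have C0 : 0 < C by rewrite !mulr_gt0 ?powR_gt0.
have sm := rate_small (ltac:(rewrite invr_gt0; exact: C0) : 0 < C^-1).
near=> n; set w := omega (h n).
have /andP[w0 wC] : 0 < w < C^-1 by rewrite /w; near: n.
have nw : n%:R <= w `^ (- a) by rewrite /w; near: n.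
have al : alpha n <= A * (n%:R `^ gamma).
  have := @ler_norm R (alpha n); move=> /le_trans; apply.
  rewrite -[X in A * X]ger0_norm ?powR_ge0//.
  by near: n; exact: alA.
have al2 : alpha n `^ p <= A `^ p * w `^ (- b).
  apply: (@le_trans _ _ ((A * (w `^ (- a)) `^ gamma) `^ p)).
    apply: ge0_ler_powR; rewrite ?nnegrE ?(ltW p0) ?(ltW (al0 n))//.
      by rewrite mulr_ge0 ?powR_ge0// ltW.
    apply: le_trans al _; rewrite ler_wpM2l ?(ltW A0)//.
    by apply: ge0_ler_powR; rewrite ?nnegrE ?(ltW g0) ?powR_ge0.
  rewrite powRM ?powR_ge0 ?(ltW A0)// -!powRrM.
  by rewrite /b -mulNr -mulNr !mulrA.
pose x := kap * (sigma ^+ 2 / w ^+ 2).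
have x0 : 0 < x by rewrite mulr_gt0// divr_gt0// exprn_gt0.
have ex : expR (- x) <= pow_cst q * (kap * sigma ^+ 2) `^ (- q) * w `^ (b + p + 1).
  have := powR_le_expR q0 (ltW x0).
  have xq : x `^ q = (kap * sigma ^+ 2) `^ q / w `^ (b + p + 1).
    rewrite /x mulrA powRM ?(ltW ks0) ?invr_ge0 ?sqr_ge0//; congr (_ * _).
    rewrite -(powR_inv1 (sqr_ge0 w)) -powR_mulrn ?(ltW w0)// -!powRrM -powRN.
    by congr (_ `^ _); rewrite /q; field.
  rewrite xq => H; rewrite expRN powRN -lef_pV2 ?posrE ?invr_gt0 ?expR_gt0//; last first.
    by rewrite !mulr_gt0 ?invr_gt0 ?powR_gt0.
  rewrite invrK !invfM invrK -mulrA ler_pdivrMl//.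
apply: (@le_trans _ _ (A `^ p * w `^ (- b) * (K * (pow_cst q *
    (kap * sigma ^+ 2) `^ (- q) * w `^ (b + p + 1))))).
  apply: ler_pM; rewrite ?powR_ge0// ?mulr_ge0 ?expR_ge0 ?(ltW K0)//.
  by rewrite ler_wpM2l ?(ltW K0).
have -> : A `^ p * w `^ (- b) * (K * (pow_cst q *
    (kap * sigma ^+ 2) `^ (- q) * w `^ (b + p + 1))) =
    C * (w `^ (- b) * w `^ (b + p + 1)) by rewrite /C; ring.
rewrite -powRD; last by rewrite (gt_eqF w0) implybT.
have -> : - b + (b + p + 1) = p + 1 by ring.
rewrite powRD; last by rewrite (gt_eqF w0) implybT.
rewrite powRr1 ?(ltW w0)// mulrCA ler_piMr ?powR_ge0//.
by rewrite mulrC -ler_pdivlMr// div1r ltW.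
Unshelve. all: by end_near. Qed.

End negligible.

Section local_design.
Context (R : realType) (beta x0 : R) (nu : R -> R) (mu : design_density R).

Lemma design_class_ball : design_class x0 beta nu mu ->
  exists2 r, 0 < r & forall x, 0 < `|x - x0| < r -> mu x = nu `|x - x0|.
Proof.
move=> [_]; rewrite /dnbhs near_withinE => -[r /= r0 rP].
exists r => // x /andP[xx0 xr]; apply: rP; first by rewrite /= distrC.
by rewrite -subr_eq0 -normr_gt0.
Qed.

Variable r : R.
Hypothesis nubeta : RV beta nu.
Hypothesis mu_nu : forall x, 0 < `|x - x0| < r -> mu x = nu `|x - x0|.

Lemma design_unit_itv t : 0 < t < r -> x0 + t \in `[0, 1].
Proof.
move=> /andP[t0 tr]; apply: contraT => out.
have e : x0 + t - x0 = t by rewrite addrAC subrr add0r.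
have := design_support mu out; rewrite mu_nu e gtr0_norm ?t0//.
by move=> nu0; have := RV_gt0 nubeta t0; rewrite nu0 ltxx.
Qed.

(** One plus the chi-square divergence between the laws of one observation under
the bump and under 0, in the form given by [integral_obs_ratio_sqr]. *)
Lemma chi2_bump (sigma theta h : R) : 0 < sigma -> 0 < h < r ->
  theta ^+ 2 / sigma ^+ 2 <= 2^-1 ->
  (\int[design_law mu]_x (expR (bump x0 h theta x ^+ 2 / sigma ^+ 2))%:E <=
   (1 + 4 * (theta ^+ 2 / sigma ^+ 2) * cumul nu h)%:E)%E.
Proof.
move=> sg0 /andP[h0 hr] small; set u := theta ^+ 2 / sigma ^+ 2 in small *.
have u0 : 0 <= u by rewrite divr_ge0 ?sqr_ge0.
have eu : expR u - 1 <= 2 * u.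
  have := expR_ge1Dx (- u); rewrite expRN -[X in _ <= X]div1r.
  rewrite ler_pdivlMr ?expR_gt0// => H; have := expR_gt0 u; nra.
have eu0 : 0 <= expR u - 1 by rewrite subr_ge0 -expR0 ler_expR.
pose A : set (measurableTypeR R) := `[x0 - h, x0 + h]%classic.
have mA : measurable A by exact: measurable_itv.
have mI : measurable_fun [set: measurableTypeR R] (fun x => (\1_A x)%:E : \bar R).
  by apply/measurable_EFinP; exact: measurable_indic.
have I0 x : (0 <= (\1_A x)%:E :> \bar R)%E by rewrite lee_fin.
have c0 : (0 <= (expR u - 1)%:E :> \bar R)%E by rewrite lee_fin.
have -> : (\int[design_law mu]_x (expR (bump x0 h theta x ^+ 2 / sigma ^+ 2))%:E =
    \int[design_law mu]_x (1 + (expR u - 1)%:E * (\1_A x)%:E))%E.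
  apply: eq_integral => x _; rewrite -EFinM -EFinD /bump !indicE -/A.
  case: (x \in A); first by rewrite !mulr1 addrC subrK.
  by rewrite !mulr0 expr0n/= mul0r expR0 addr0.
rewrite (ge0_integralD (design_law mu) measurableT (fun x _ => lee01) (measurable_cst _)
  (fun x _ => mule_ge0 c0 (I0 x)) (emeasurable_funM (measurable_cst _) mI)).
rewrite (ge0_integralZl (design_law mu) measurableT mI (fun x _ => I0 x))//.
rewrite integral_cst// mul1e integral_indic// setIT.
rewrite -[X in (X + _ <= _)%E]/(design_law mu [set: _]).
apply: (@le_trans _ _ (1 + (expR u - 1)%:E * (2 * cumul nu h)%:E)%E).
  apply: leeD; first by rewrite (probability_setT (design_law mu)).
  apply: lee_wpmul2l => //; exact: (design_law_window nubeta mu_nu h0 hr).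
rewrite -EFinM -EFinD lee_fin lerD2l.
have Vh : 0 <= cumul nu h.
  by apply/ltW/(cumul_gt0 nubeta) => //; exact: (design_integrable mu_nu (lt_trans h0 hr)).
by have := ler_wpM2r Vh eu; lra.
Qed.

End local_design.

Lemma local_class_approx (R : realType) (delta x0 s h : R) (omega f : R -> R) :
  local_class delta x0 s omega f -> 0 < h <= delta -> 0 < omega h ->
  exists2 P : {poly R}, (size P <= (degree_of s).+1)%N &
    forall x, x \in `[0, 1] -> `|x - x0| <= h -> `|f x - P.[x - x0]| <= 2 * omega h.
Proof.
move=> /[apply] inf om0.
have : (ereal_inf [set ereal_sup [set (`|f x - P.[x - x0]|%R)%:E
       | x in [set x | x \in `[0%R, 1%R] /\ (`|x - x0| <= h)%R]]
     | P in [set P : {poly R} | (size P <= (degree_of s).+1)%N]] < (2 * omega h)%:E)%E.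
  by apply: le_lt_trans inf _; rewrite lte_fin; lra.
move=> /ereal_inf_lt[_ [P sP <-] Plt]; exists P => // x x01 xh.
rewrite -lee_fin; apply: le_trans (ltW Plt).
by apply: ereal_sup_ubound; exists x.
Qed.

(** * Minimax bounds *)

Lemma minimax_upper (R : realType) (k n : nat) (p sigma x0 h m r alpha C1 : R)
    (mu : design_density R) (q : 'I_k.+1 -> R) (Sigma : set (R -> R)) :
  Sigma (cst 0) -> 0 < p -> 0 < sigma -> 0 < h -> 0 < m -> 0 < r -> 0 <= alpha ->
  sigma ^+ 2 / r ^+ 2 <= C1 * m ->
  (forall j : 'I_k.+1,
    design_law mu `]x0 + j.*2%:R * (h / k.*2.+1%:R),
                    x0 + j.*2.+1%:R * (h / k.*2.+1%:R)] = (q j)%:E) ->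
  (forall j, 4 * m <= n%:R * q j) ->
  alpha `^ p * (k.+1%:R * expR (- m)) <= r `^ p ->
  (forall f, Sigma f -> `|f x0| <= alpha /\
    exists2 P : {poly R}, (size P <= k.+1)%N & `|f x0 - P.[0]| <= 2 * r /\
      forall t, 0 < t <= h -> `|f (x0 + t) - P.[t]| <= 2 * r) ->
  (minimax_risk p sigma x0 Sigma mu n <= (r * (risk_cst k p C1 + 1) `^ p^-1)%:E)%E.
Proof.
move=> S0 p0 sg0 h0 m0 r0 a0 noise qE qm tail app.
have rc0 : 0 <= risk_cst k p C1 by rewrite /risk_cst !mulr_ge0 ?expR_ge0// ler0n.
pose B := r `^ p * (risk_cst k p C1 + 1).
have B0 : 0 <= B by rewrite mulr_ge0 ?powR_ge0// addr_ge0.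
have -> : r * (risk_cst k p C1 + 1) `^ p^-1 = B `^ p^-1.
  rewrite /B powRM ?powR_ge0 ?addr_ge0// -powRrM mulfV ?gt_eqF//.
  by rewrite powRr1// ltW.
rewrite -poweR_EFin /minimax_risk; apply: gt0_ler_poweR.
- by rewrite invr_ge0 ltW.
- rewrite in_itv/= leey andbT; apply: le_ereal_inf_tmp => _ [T _ <-].
  pose f0 : {mfun R >-> R} := cst 0.
  apply: (@le_trans _ _
    (\int[sample_law f0 mu sigma n]_z ((`|T z - f0 x0| `^ p)%R)%:E)%E).
    by apply: integral_ge0 => z _; rewrite lee_fin powR_ge0.
  by apply: ereal_sup_ubound; exists f0; [exact: S0|].
- by rewrite in_itv/= leey lee_fin B0.
apply: ge_ereal_inf.
exists (ereal_sup [set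
       (\int[sample_law f mu sigma n]_z ((`|est k x0 h m z - f x0| `^ p)%R)%:E)%E
     | f in [set f : {mfun R >-> R} | Sigma f]]).
  by exists (est k x0 h m).
apply: ge_ereal_sup => _ [f Sf <-].
have [fa [P sP [P0 Pt]]] := app f Sf.
have fPt t : (exists j, @block R k h j t) -> `|f (x0 + t) - P.[t]| <= 2 * r.
  by move=> [j /(block_bound h0)]; exact: Pt.
apply: le_trans (est_risk p0 sg0 h0 m0 r0 a0 noise qE qm sP P0 fPt fa) _.
by rewrite lee_fin /B mulrDr mulr1 lerD2l.
Qed.

Theorem theorem1 (R : realType) (p s beta : R) (p0 : 0 < p)
    (sbeta : (0 < s /\ -1 < beta) \/ (0 < s <= 1 /\ beta = -1)) :
  exists c C : R, [/\ 0 < c, 0 < C &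
    forall omega nu : R -> R, RV s omega -> RV beta nu ->
    exists2 l : R -> R, RV 0 l &
    forall (sigma x0 : R) (mu : design_density R) (h alpha : nat -> R)
      (gamma : R),
    0 < sigma -> x0 \in `[0, 1] -> design_class x0 beta nu mu ->
    (\forall n \near \oo, smallest_bandwidth sigma omega nu n (h n)) ->
    (forall n, 0 < alpha n) ->
    0 < gamma -> alpha =O_\oo (fun n => n%:R `^ gamma) ->
    (\forall n \near \oo, omega (h n) <= alpha n) ->
    let risk n :=
      minimax_risk p sigma x0 (Sigma_class (h n) (alpha n) x0 s omega) mu n in
    same_order c C risk
      (fun n => sigma `^ (2 * s / (1 + 2 * s + beta)) *
                n%:R `^ (- (s / (1 + 2 * s + beta))) * l (n%:R^-1)) /\
    same_order c C risk (fun n => omega (h n))].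
Proof.
have s0 : 0 < s by case: sbeta => [[]|[/andP[]]].
have beta1 : -1 <= beta by case: sbeta => [[_ /ltW]//|[_ ->]].
set k := degree_of s.
have kb : (-1 < beta) \/ (beta = -1 /\ k = 0%N).
  case: sbeta => [[_ ?]|[/andP[_ s1] b1]]; [by left|right; split=> //].
  have [ks _] := degree_ofP s0.
  by apply/eqP; rewrite -leqn0 -ltnS -(ltr_nat R); exact: lt_le_trans s1.
have [kap kap0 kapP] := block_mass kb.
(* With m a quarter of the guaranteed mean kap * n * V (h n) of a block, that is
   m = kap / 8 * (sigma^2 / omega^2), this is the ratio (sigma^2 / omega^2) / m. *)
pose C1 := 8 / kap.
pose Cu := (risk_cst k p C1 + 1) `^ p^-1.
pose cl : R := 4^-1 * (4^-1) `^ p^-1.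
have rc0 : 0 <= risk_cst k p C1 by rewrite /risk_cst !mulr_ge0 ?expR_ge0// ler0n.
have Cu0 : 0 < Cu by rewrite powR_gt0// ltr_wpDl.
have cl0 : 0 < cl by rewrite mulr_gt0 ?powR_gt0 ?invr_gt0.
exists (cl / 2), (2 * Cu); split; [by rewrite divr_gt0|by rewrite mulr_gt0|].
move=> omega nu omegas nubeta.
have [nuint|nonint] := pselect (exists2 d, 0 < d &
  (\int[@lebesgue_measure R]_(t in `]0%R, d]) (nu t)%:E < +oo)%E); last first.
  (* no design density is compatible with nu *)
  exists (fun=> 1).
    split=> [x _|//|y y0]; first exact: cvg_cst.
    by rewrite divr1 powRr0; exact: cvg_cst.
  move=> sigma x0 mu h alpha gamma _ _ /design_class_ball[r r0 mu_nu].
  by exfalso; apply: nonint; exact: (design_integrable mu_nu r0).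
have [l lRV lP] := rate_function s0 beta1 omegas nubeta nuint.
exists l => // sigma x0 mu h alpha gamma sg0 x01 dc hn al0 g0 alO oal risk.
have omp t : 0 < t -> 0 < omega t by exact: RV_gt0 omegas.
have [r r0 mu_nu] := design_class_ball dc.
suff both : \forall n \near \oo,
    ((cl * omega (h n))%:E <= risk n <= (Cu * omega (h n))%:E)%E.
  have rate := lP sigma h sg0 hn.
  have hs := bandwidth_cvg0 s0 beta1 omegas nubeta nuint sg0 hn ltr01.
  split; rewrite /same_order; near=> n.
  - have /andP[l1 u1] : ((cl * omega (h n))%:E <= risk n <= (Cu * omega (h n))%:E)%E.
      by near: n.
    set v := _ * l _.
    have /andP[l2 u2] : v / 2 <= omega (h n) <= 2 * v by rewrite /v; near: n.
    rewrite (le_trans _ l1) ?(le_trans u1)// lee_fin.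
      by rewrite [2 * Cu]mulrC -mulrA ler_wpM2l ?(ltW Cu0).
    by rewrite -mulrA [2^-1 * v]mulrC ler_wpM2l ?(ltW cl0).
  - have /andP[l1 u1] : ((cl * omega (h n))%:E <= risk n <= (Cu * omega (h n))%:E)%E.
      by near: n.
    have /andP[hp _] : 0 < h n < 1 by near: n.
    have oh := RV_gt0 omegas hp.
    rewrite (le_trans _ l1) ?(le_trans u1)// lee_fin ler_wpM2r ?(ltW oh)//.
      by rewrite ler_peMl ?(ltW Cu0)// ler1n.
    by rewrite ler_pdivrMr// ler_peMr ?(ltW cl0)// ler1n.
have hs := bandwidth_cvg0 s0 beta1 omegas nubeta nuint sg0 hn r0.
have rs := rate_small s0 beta1 sg0 omegas nubeta nuint hn sg0.
have kap8 : 0 < kap / 8 by rewrite divr_gt0.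
have tl := tail_negligible s0 beta1 sg0 omegas nubeta nuint hn p0 g0 kap8
  (ltr0Sn _ k) al0 alO.
have bm : \forall n \near \oo, forall j : 'I_k.+1,
    kap * cumul nu (h n) <= cumul nu (j.*2.+1%:R * (h n / k.*2.+1%:R)) -
                            cumul nu (j.*2%:R * (h n / k.*2.+1%:R)).
  have /near0rP[d d0 dP] := kapP nu nubeta nuint.
  apply: filterS (bandwidth_cvg0 s0 beta1 omegas nubeta nuint sg0 hn d0) => n.
  exact: dP.
near=> n.
have n0 : (0 < n)%N by near: n; exact: nbhs_infty_gt.
have nR : 0 < n%:R :> R by rewrite ltr0n.
have [hp heq _] : smallest_bandwidth sigma omega nu n (h n) by near: n.
have /andP[_ hr] : 0 < h n < r by near: n.
have Gn := (bandwidthP omegas nubeta nuint sg0 n0 hp).1 heq.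
have /andP[w0 wsg] : 0 < omega (h n) < sigma by near: n.
have Vh := cumul_gt0 nubeta nuint hp.
have wal : omega (h n) <= alpha n by near: n.
have nV : n%:R * cumul nu (h n) = sigma ^+ 2 / omega (h n) ^+ 2 / 2.
  apply: (@mulfI _ (omega (h n) ^+ 2)); first by rewrite gt_eqF// exprn_gt0.
  have -> : omega (h n) ^+ 2 * (n%:R * cumul nu (h n)) =
      n%:R * info omega nu (h n) by rewrite /info; ring.
  by rewrite Gn; field; rewrite !gt_eqF.
apply/andP; split.
- have -> : cl * omega (h n) = (omega (h n) / 2) / 2 * (4^-1) `^ p^-1.
    by rewrite /cl; field.
  apply: (minimax_two_point p0 sg0 _ hp).
  + by rewrite divr_gt0.
  + by apply: zero_Sigma; [exact: omp|exact: ltW (al0 n)].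
  + apply: bump_Sigma; [exact: omp|by rewrite divr_ge0// ltW|].
    by apply: le_trans wal; rewrite ler_pdivrMr// ler_peMr ?(ltW w0)// ler1n.
  + have rs2 : omega (h n) ^+ 2 / sigma ^+ 2 <= 1.
      by rewrite ler_pdivrMr ?exprn_gt0// mul1r lerXn2r ?nnegrE ?(ltW w0) ?(ltW sg0) ?(ltW wsg).
    have E4 : (omega (h n) / 2) ^+ 2 / sigma ^+ 2 = omega (h n) ^+ 2 / sigma ^+ 2 / 4.
      by field; rewrite gt_eqF.
    apply: le_trans (chi2_bump nubeta mu_nu sg0 _ _) _.
    * by rewrite hp.
    * by rewrite E4; lra.
    * rewrite lee_fin E4; apply: le_trans (expR_ge1Dx _); rewrite lerD2l.
      rewrite le_eqVlt; apply/orP; left; apply/eqP.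
      apply: (@mulfI _ n%:R); first by rewrite gt_eqF.
      have -> : n%:R * (4 * (omega (h n) ^+ 2 / sigma ^+ 2 / 4) * cumul nu (h n)) =
        omega (h n) ^+ 2 / sigma ^+ 2 * (n%:R * cumul nu (h n)) by field; rewrite gt_eqF.
      by rewrite nV; field; rewrite !gt_eqF.
- rewrite mulrC.
  pose m := kap / 8 * (sigma ^+ 2 / omega (h n) ^+ 2).
  have m0 : 0 < m by rewrite mulr_gt0// divr_gt0// exprn_gt0.
  have bb j : 0 <= j.*2%:R * (h n / k.*2.+1%:R) :> R by rewrite mulr_ge0// divr_ge0// ltW.
  apply: (@minimax_upper _ _ _ _ _ _ (h n) m (omega (h n)) (alpha n) C1 mu
    (fun j => cumul nu (j.*2.+1%:R * (h n / k.*2.+1%:R)) -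
              cumul nu (j.*2%:R * (h n / k.*2.+1%:R)))) => //.
  + by apply: zero_Sigma; [exact: omp|exact: ltW (al0 n)].
  + exact: ltW (al0 n).
  + by rewrite /C1 /m le_eqVlt; apply/orP; left; apply/eqP; field; rewrite !gt_eqF.
  + move=> j; apply: (design_law_right nubeta mu_nu) => //.
      by rewrite ler_wpM2r ?divr_ge0 ?(ltW hp)// ler_nat.
    apply: le_lt_trans hr; rewrite mulrCA ler_piMr ?(ltW hp)//.
    by rewrite ler_pdivrMr// mul1r ler_nat ltnS leq_double -ltnS.
  + move=> j; have Hj : kap * cumul nu (h n) <= cumul nu (j.*2.+1%:R * (h n / k.*2.+1%:R)) -
        cumul nu (j.*2%:R * (h n / k.*2.+1%:R)).
      by move: j; near: n.
    apply: le_trans (ler_wpM2l (ltW nR) Hj).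
    by rewrite [n%:R * _]mulrCA nV /m; lra.
  + by rewrite /m; near: n.
  + move=> f [lf bf]; split; first exact: bf.
    have [P sP Papp] := local_class_approx lf (introT andP (conj hp (lexx _))) w0.
    exists P => //; split.
      by have := Papp x0 x01; rewrite subrr normr0; apply; exact: ltW.
    move=> t /andP[t0 th]; have e : x0 + t - x0 = t by rewrite addrAC subrr add0r.
    have := Papp (x0 + t); rewrite e gtr0_norm//; apply => //.
    by apply: (design_unit_itv nubeta mu_nu); rewrite t0 (le_lt_trans th).
Unshelve. all: by end_near. Qed.
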